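(* Let $\tau:I\to I$ be unimodal and surjective, with critical point $c$. Then the dimension module $DG(\tau)$ is cyclic, with generator $I(0,1)$. If the critical point $c$ is eventually periodic, then $\tau$ is Markov. In that case, if the incidence matrix is $A$, then $(DG(\tau),DG(\tau)^+,\mathcal L_* )\cong(G_A,G_A^+,A_* )$. If $c$ is not eventually periodic, then $DG(\tau)\cong\mathbb Z[t,t^{-1}]$ as abelian groups, with the action of $\mathcal L_*$ given by multiplication by $t$.
   Context: Unimodal maps. Let $I=[0,1]$. A continuous map $\tau:I\to I$ is unimodal if there is $c\in(0,1)$ (the critical point) such that $\tau$ is (strictly) increasing on $[0,c]$ and (strictly) decreasing on $[c,1]$. It is a piecewise monotonic map with associated (maximal) partition $C=\{0,c,1\}$. The generalized orbit $I_1$ of $C$ is the smallest subset of $I$ containing $C$ and closed under $\tau$ and $\tau^{-1}$ (taking images and preimages); $I_0=I\setminus I_1$. Associated local homeomorphism. The disconnection $X$ of $I$ at points of $I_1$ is the totally ordered set obtained from $I$ by replacing each $x\in I_1\setminus\{0,1\}$ by two points $x^-<x^+$, with the order topology (it is homeomorphic to a compact subset of $\mathbb R$); $\pi:X\to I$ is the collapse map, $\pi(x^\pm)=x$ and $\pi(x)=x$ for $x\in I_0$. For any $x\in I$, $x^-$ and $x^+$ denote the smallest and largest points of $\pi^{-1}(x)$ (equal if $x\in I_0\cup\{0,1\}$). For $a,b\in X$, $[a,b]_X=\{x\in X\mid a\le x\le b\}$. With $X_0=\pi^{-1}(I_0)$, the local homeomorphism associated with $\tau$ is the unique continuous map $\sigma:X\to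 X$ with $\pi\circ\sigma=\tau\circ\pi$ on $X_0$. Dimension module. The transfer map $\mathcal L:C(X,\mathbb Z)\to C(X,\mathbb Z)$ is $(\mathcal Lf)(x)=\sum_{\sigma(y)=x}f(y)$. For $f,g\in C(X,\mathbb Z)$ put $f\sim g$ if $\mathcal L^nf=\mathcal L^ng$ for some $n\ge0$. $DG(\tau)=G_\sigma$ is the group of equivalence classes $[f]$, with $[f]+[g]=[f+g]$ and positive cone $DG(\tau)^+=\{[f]\mid f\ge 0\}$; $\mathcal L_*[f]=[\mathcal Lf]$. Since $\tau$ is surjective, $\mathcal L_*$ is an automorphism of $DG(\tau)$, and $DG(\tau)$ is a $\mathbb Z[t,t^{-1}]$-module with $t$ acting as $\mathcal L_*$. A module $G$ is cyclic with generator $e$ if $G=\mathbb Z[t,t^{-1}]e$. For $a<b$ in $I_1$, $I(a,b)$ denotes the order interval $[a^+,b^-]_X$, identified with the class of its characteristic function in $DG(\tau)$; so $I(0,1)=[1_X]$. Markov maps. $\tau$ is Markov if there is a partition $0=b_0<b_1<\dots<b_q=1$ with each $b_i\in I_1$ such that for each $i$, $\tau$ is monotonic on $(b_{i-1},b_i)$, $\overline{\tau((b_{i-1},b_i))}$ is a union of intervals of the form $[b_{j-1},b_j]$, and for some $k\ge0$, $\tau^k(C)\subset\{b_0,\dots,b_q\}$. With $E_i=[b_{i-1}^+,b_i^-]_X$, the incidence matrix is the $q\times q$ zero-one matrix with $A_{ij}=1$ iff $\sigma(E_i)\supset E_j$. The triple of $A$. $G_A$ is the stationary inductive limit of $\mathbb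 Z^q\xrightarrow{A}\mathbb Z^q\xrightarrow{A}\cdots$ in the category of ordered abelian groups ($A$ acting by right multiplication on row vectors), $G_A^+$ is its positive cone, and $A_*$ is the automorphism induced by $A$: if $[v,n]$ is the element represented by $v$ in the $n$-th copy of $\mathbb Z^q$, $A_*[v,n]=[vA,n]$. An isomorphism of triples is an isomorphism of ordered groups intertwining the automorphisms. *)

(* Defs.v *)
From HB Require Import structures.
From mathcomp Require Import all_boot all_order all_algebra.
From mathcomp Require Import generic_quotient fraction.
From mathcomp Require Import finmap zify.
From mathcomp Require Import all_classical all_reals all_analysis.

Set Implicit Arguments.
Unset Strict Implicit.
Unset Printing Implicit Defensive.

Import Order.TTheory GRing.Theory Num.Theory.
Import numFieldNormedType.Exports.

Local Open Scope classical_set_scope.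
Local Open Scope quotient_scope.
Local Open Scope ring_scope.

(* A map I -> I, I = [0, 1], is a function tau : R -> R sending I to itself;
   its values outside I are never used. *)

Section interval_maps.
Context {R : realType}.
Implicit Types (tau : R -> R) (c x : R) (C S : set R).

Definition unimodal tau c :=
  [/\ 0 < c < 1,
      set_fun `[0, 1] `[0, 1] tau,
      {within `[0, 1], continuous tau},
      {in `[0, c] &, {homo tau : x y / x < y}} &
      {in `[c, 1] &, {homo tau : x y /~ x < y}}].

Definition surjective_on_I tau := set_surj `[0, 1] `[0, 1] tau.

Definition crit_partition c : set R := [set 0; c; 1].

Definition fully_invariant tau S :=
  [/\ S `<=` `[0, 1],
      (forall x, S x -> S (tau x)) &
      (forall x, x \in `[0, 1] -> S (tau x) -> S x)].

(* The smallest subset of I that contains C and is closed under images and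
   preimages by tau; it is I_1 when C is the partition of tau. *)
Definition gen_orbit tau C : set R := smallest (fully_invariant tau) C.

Definition eventually_periodic tau x :=
  exists n p : nat, (0 < p)%N /\ iter (n + p) tau x = iter n tau x.

End interval_maps.

(* Disconnection of I at the points of S: in the lexicographic order on pairs,
   (x, false) stands for x^- and (x, true) for x^+; a point that is not doubled
   is represented by (x, false) only. *)

Section disconnection.
Context {R : realType}.
Variable S : set R.

Definition dpoint_pred : pred (R *l bool) := fun p =>
  (p.1 \in `[0, 1]) && (p.2 ==> (p.1 \in S `\` [set 0; 1])).

Record dpoint := DPoint { dpoint_val : R *l bool; _ : dpoint_pred dpoint_val }.

HB.instance Definition _ := [isSub for dpoint_val].
HB.instance Definition _ := [Choice of dpoint by <:].
HB.instance Definition _ :=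
  [SubChoice_isSubOrder of dpoint by <:
     with Order.Disp tt tt].

Definition disconnection := order_topology dpoint.
HB.instance Definition _ := OrderTopological.on disconnection.

Definition collapse (x : disconnection) : R := (dpoint_val x).1.

Fact dpoint1_subproof : dpoint_pred (1, false).
Proof. by rewrite /dpoint_pred /= in_itv /= ler01 lexx. Qed.

(* A default value for [lower_pt] and [upper_pt] outside I. *)
Definition dpoint1 : disconnection := DPoint dpoint1_subproof.

Local Open Scope order_scope.

Definition lower_pt (a : R) : disconnection :=
  xget dpoint1 [set x | collapse x = a /\
                        forall y : disconnection, collapse y = a -> x <= y].

Definition upper_pt (a : R) : disconnection :=
  xget dpoint1 [set x | collapse x = a /\
                        forall y : disconnection, collapse y = a -> y <= x].

(* [a^+, b^-]_X *)
Definition dinterval (a b : R) : set disconnection :=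
  [set` `[upper_pt a, lower_pt b]].

Definition assoc_local_homeo_spec (tau : R -> R)
    (sigma : disconnection -> disconnection) :=
  continuous sigma /\
  forall x, ~ S (collapse x) -> collapse (sigma x) = tau (collapse x).

(* The default [id] is irrelevant whenever a (necessarily unique) map
   satisfying the specification exists. *)
Definition assoc_local_homeo (tau : R -> R) : disconnection -> disconnection :=
  xget (id : disconnection -> disconnection)
    [set sigma | assoc_local_homeo_spec tau sigma].

End disconnection.

Arguments dinterval {R} S a b.

Section continuous_int.
Variable T : topologicalType.

Definition cont_int_pred : {pred T -> int} :=
  fun f => `[< continuous (f : T -> discrete_topology int) >].

Lemma cont_intP (f : T -> int) :
  reflect (forall x, \forall y \near x, f y = f x) (f \in cont_int_pred).
Proof.
rewrite unfold_in /cont_int_pred; apply: (iffP (asboolP _)) => fC x.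
  by have /discrete_cvg := fC x; exact.
by apply/discrete_cvg; exact: (fC x).
Qed.

Fact cont_int_zmod_closed : zmod_closed cont_int_pred.
Proof.
split=> [|f g /cont_intP fC /cont_intP gC]; apply/cont_intP => x.
  exact: filterE.
by apply: filterS2 (fC x) (gC x) => y fy gy; rewrite !fctE fy gy.
Qed.

HB.instance Definition _ :=
  GRing.isZmodClosed.Build (T -> int) cont_int_pred cont_int_zmod_closed.

Record cont_int := ContInt {
  cont_int_val :> T -> int;
  _ : cont_int_val \in cont_int_pred }.

HB.instance Definition _ := [isSub for cont_int_val].
HB.instance Definition _ := [Choice of cont_int by <:].
HB.instance Definition _ := [SubChoice_isSubZmodule of cont_int by <:].

(* [f] itself if it is continuous, and [0] otherwise. *)
Definition to_cont_int (f : T -> int) : cont_int := insubd 0 f.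

End continuous_int.

Section dimension_group.
Variables (T : topologicalType) (sigma : T -> T).
Implicit Types f g : T -> int.

(* [fset_set] is empty on infinite sets, so infinite fibres contribute 0. *)
Definition transfer f : T -> int :=
  fun x => \sum_(y <- fset_set (sigma @^-1` [set x])) f y.

Lemma transferB f g : transfer (f - g) = transfer f - transfer g.
Proof. by apply/funext => x; rewrite !fctE /transfer -sumrB. Qed.

Lemma iter_transferB n f g :
  iter n transfer (f - g) = iter n transfer f - iter n transfer g.
Proof. by elim: n => //= n ->; rewrite transferB. Qed.

Definition dim_equiv (f g : cont_int T) : bool :=
  `[< exists n, iter n transfer f = iter n transfer g >].

Lemma dim_equiv_refl : reflexive dim_equiv.
Proof. by move=> f; apply/asboolP; exists 0%N. Qed.

Lemma dim_equiv_sym : symmetric dim_equiv.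
Proof.
by move=> f g; apply/asboolP/asboolP => -[n fgn]; exists n; rewrite fgn.
Qed.

Lemma dim_equiv_trans : transitive dim_equiv.
Proof.
move=> g f h /asboolP[n fg] /asboolP[m gh]; apply/asboolP; exists (n + m)%N.
by rewrite addnC iterD fg -iterD addnC iterD gh -iterD.
Qed.

Canonical dim_equiv_rel :=
  EquivRel dim_equiv dim_equiv_refl dim_equiv_sym dim_equiv_trans.

Definition dim_group := {eq_quot dim_equiv}.
HB.instance Definition _ : EqQuotient _ dim_equiv dim_group :=
  EqQuotient.on dim_group.
HB.instance Definition _ := Choice.on dim_group.

Definition dim_class (f : cont_int T) : dim_group := \pi f.

Lemma dim_classP (f g : cont_int T) :
  reflect (exists n, iter n transfer f = iter n transfer g)
          (dim_class f == dim_class g).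
Proof. by rewrite /dim_class eqmodE; exact: asboolP. Qed.

Lemma dim_class_subr (f f' g g' : cont_int T) :
  dim_class f = dim_class f' -> dim_class g = dim_class g' ->
  dim_class (f - g) = dim_class (f' - g').
Proof.
move=> /eqP/dim_classP[n fn] /eqP/dim_classP[m gm].
apply/eqP/dim_classP; exists (n + m)%N.
rewrite (iter_transferB _ f g) (iter_transferB _ f' g').
congr (_ - _); last by rewrite iterD gm -iterD.
by rewrite addnC iterD fn -iterD.
Qed.

Definition dim_sub (x y : dim_group) := dim_class (repr x - repr y).
Definition dim_zero : dim_group := dim_class 0.
Definition dim_opp (x : dim_group) := dim_sub dim_zero x.
Definition dim_add (x y : dim_group) := dim_class (repr x + repr y).

Lemma dim_reprK (x : dim_group) : dim_class (repr x) = x.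
Proof. exact: reprK. Qed.

Lemma dim_class_opp (f : cont_int T) : dim_opp (dim_class f) = dim_class (- f).
Proof.
rewrite /dim_opp /dim_sub -[in RHS]sub0r.
by apply: dim_class_subr; rewrite dim_reprK.
Qed.

Lemma dim_class_add (f g : cont_int T) :
  dim_add (dim_class f) (dim_class g) = dim_class (f + g).
Proof.
rewrite /dim_add -[repr (dim_class g)]opprK -[g in RHS]opprK.
apply: dim_class_subr; rewrite ?dim_reprK // -[LHS]dim_class_opp.
by rewrite dim_reprK dim_class_opp.
Qed.

Lemma dim_addA : associative dim_add.
Proof.
move=> x y z; rewrite -[x]dim_reprK -[y]dim_reprK -[z]dim_reprK.
by rewrite !dim_class_add addrA.
Qed.

Lemma dim_addC : commutative dim_add.
Proof. by move=> x y; rewrite /dim_add addrC. Qed.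

Lemma dim_add0 : left_id dim_zero dim_add.
Proof. by move=> x; rewrite -[x]dim_reprK dim_class_add add0r. Qed.

Lemma dim_addN : left_inverse dim_zero dim_opp dim_add.
Proof.
by move=> x; rewrite -[x]dim_reprK dim_class_opp dim_class_add addNr.
Qed.

HB.instance Definition _ :=
  GRing.isZmodule.Build dim_group dim_addA dim_addC dim_add0 dim_addN.

Definition dim_pos : set dim_group :=
  [set dim_class f | f in [set f : cont_int T | forall x, 0 <= f x]].

(* [to_cont_int] changes nothing when the transfer map preserves continuity,
   as it does for a local homeomorphism of a compact space; the result then
   does not depend on the representative [repr x]. *)
Definition dim_transfer (x : dim_group) : dim_group :=
  dim_class (to_cont_int (transfer (repr x))).

Definition dim_indic (A : set T) : dim_group :=
  dim_class (to_cont_int (fun x => (x \in A)%:R)).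

End dimension_group.

(* Z[t, t^-1] is the subring of the field of fractions of Z[t] formed by the
   fractions whose denominator is a power of t. *)

Local Notation "p %:F" := (@tofrac {poly int} p).

Definition laurent_pred : {pred {fraction {poly int}}} := fun a =>
  `[< exists np : nat * {poly int}, a * ('X^(np.1))%:F = np.2%:F >].

Fact laurent_subring_closed : subring_closed laurent_pred.
Proof.
split; first by apply/asboolP; exists (0%N, 1); rewrite /= expr0 mul1r.
- move=> a b /asboolP[[n p] /= ap] /asboolP[[m q] /= bq].
  apply/asboolP; exists ((n + m)%N, p * 'X^m - q * 'X^n) => /=.
  by rewrite exprD tofracM mulrBl mulrA ap mulrCA bq tofracB !tofracM mulrC
             [X in _ - X]mulrC.
- move=> a b /asboolP[[n p] /= ap] /asboolP[[m q] /= bq].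
  apply/asboolP; exists ((n + m)%N, p * q) => /=.
  by rewrite exprD !tofracM mulrACA ap bq.
Qed.

HB.instance Definition _ :=
  GRing.isSubringClosed.Build {fraction {poly int}} laurent_pred
    laurent_subring_closed.

Record laurent := Laurent {
  laurent_val : {fraction {poly int}};
  laurent_valP : laurent_val \in laurent_pred }.

HB.instance Definition _ := [isSub for laurent_val].
HB.instance Definition _ := [Choice of laurent by <:].
HB.instance Definition _ := [SubChoice_isSubComNzRing of laurent by <:].

Fact laurent_t_subproof : 'X%:F \in laurent_pred.
Proof. by apply/asboolP; exists (0%N, 'X); rewrite /= expr0 mulr1. Qed.

Definition laurent_t : laurent := Laurent laurent_t_subproof.

(* Some (n, p) with a = t^-n * p. *)
Definition laurent_frac (a : laurent) : nat * {poly int} :=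
  sval (cid (asboolP _ (laurent_valP a))).

(* When T is an automorphism of V, [laurent_act T a v] is the product of v by a
   in the Z[t, t^-1]-module structure on V where t acts as T; it does not depend
   on the fraction chosen for a, and [aut_inv T] is the inverse of T. *)

Section laurent_module.
Variables (V : zmodType) (T : V -> V).

Definition aut_inv (v : V) : V := xget 0 [set w | T w = v].

Definition laurent_act (a : laurent) (v : V) : V :=
  let: (n, p) := laurent_frac a in
  iter n aut_inv (\sum_(i < size p) iter i T v *~ p`_i).

Definition cyclic_with_generator (e : V) :=
  forall v, exists a : laurent, v = laurent_act a e.

End laurent_module.

Section matrix_limit.
Variables (q : nat) (A : 'M[int]_q).
Implicit Types x y z : ('rV[int]_q * nat)%type.

Lemma mulmx_exprD (v : 'rV[int]_q) m n :
  v *m A ^+ (m + n) = v *m A ^+ m *m A ^+ n.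
Proof. by rewrite exprD -mulmxE mulmxA. Qed.

(* (v, n) is the row vector v in the n-th copy of Z^q: it is identified with
   (v A^k, n + k). *)
Definition lim_equiv x y : bool :=
  `[< exists k, x.1 *m A ^+ (y.2 + k) = y.1 *m A ^+ (x.2 + k) >].

Lemma lim_equiv_refl : reflexive lim_equiv.
Proof. by move=> x; apply/asboolP; exists 0%N. Qed.

Lemma lim_equiv_sym : symmetric lim_equiv.
Proof. by move=> x y; apply/asboolP/asboolP => -[k xy]; exists k. Qed.

Lemma lim_equiv_trans : transitive lim_equiv.
Proof.
move=> y x z /asboolP[k xy] /asboolP[l yz]; apply/asboolP.
exists (y.2 + k + l)%N.
rewrite (_ : z.2 + _ = (y.2 + k) + (z.2 + l))%N; last by lia.
rewrite mulmx_exprD xy -mulmx_exprD addnC mulmx_exprD yz -mulmx_exprD.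
by congr (_ *m A ^+ _); lia.
Qed.

Canonical lim_equiv_rel :=
  EquivRel lim_equiv lim_equiv_refl lim_equiv_sym lim_equiv_trans.

Definition lim_group := {eq_quot lim_equiv}.
HB.instance Definition _ : EqQuotient _ lim_equiv lim_group :=
  EqQuotient.on lim_group.
HB.instance Definition _ := Choice.on lim_group.

Definition lim_class x : lim_group := \pi x.

Lemma lim_classP x y :
  reflect (exists k, x.1 *m A ^+ (y.2 + k) = y.1 *m A ^+ (x.2 + k))
          (lim_class x == lim_class y).
Proof. by rewrite /lim_class eqmodE; exact: asboolP. Qed.

Lemma lim_reprK (u : lim_group) : lim_class (repr u) = u.
Proof. exact: reprK. Qed.

Definition lim_zero : lim_group := lim_class (0, 0%N).

Definition lim_opp (u : lim_group) : lim_group :=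
  lim_class (- (repr u).1, (repr u).2).

Definition lim_add (u v : lim_group) : lim_group :=
  let x := repr u in let y := repr v in
  lim_class (x.1 *m A ^+ y.2 + y.1 *m A ^+ x.2, (x.2 + y.2)%N).

Definition lim_aut (u : lim_group) : lim_group :=
  lim_class ((repr u).1 *m A, (repr u).2).

Lemma lim_class_repr x :
  exists k, (repr (lim_class x)).1 *m A ^+ (x.2 + k) =
            x.1 *m A ^+ ((repr (lim_class x)).2 + k).
Proof. by apply/lim_classP/eqP; exact: lim_reprK. Qed.

Lemma lim_class_opp v n : lim_opp (lim_class (v, n)) = lim_class (- v, n).
Proof.
have [k /= vk] := lim_class_repr (v, n).
by apply/eqP/lim_classP; exists k => /=; rewrite !mulNmx vk.
Qed.

Lemma lim_class_aut v n : lim_aut (lim_class (v, n)) = lim_class (v *m A, n).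
Proof.
have [k /= vk] := lim_class_repr (v, n).
have comm (w : 'rV_q) l : w *m A *m A ^+ l = w *m A ^+ l *m A.
  by rewrite -!mulmxA; congr (_ *m _); rewrite !mulmxE -exprS -exprSr.
by apply/eqP/lim_classP; exists k => /=; rewrite !comm vk.
Qed.

Lemma lim_class_add v n w m :
  lim_add (lim_class (v, n)) (lim_class (w, m)) =
  lim_class (v *m A ^+ m + w *m A ^+ n, (n + m)%N).
Proof.
have [k /=] := lim_class_repr (v, n); have [l /=] := lim_class_repr (w, m).
rewrite /lim_add; case: (repr (lim_class (w, m))) => w' m' /= wl.
case: (repr (lim_class (v, n))) => v' n' /= vk.
apply/eqP/lim_classP; exists (k + l)%N => /=.
rewrite !mulmxDl -!mulmx_exprD; congr (_ + _).
  rewrite (_ : m' + _ = (n + k) + (m' + m + l))%N; last by lia.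
  rewrite mulmx_exprD vk -mulmx_exprD.
  by congr (_ *m A ^+ _); lia.
rewrite (_ : n' + _ = (m + l) + (n' + n + k))%N; last by lia.
rewrite mulmx_exprD wl -mulmx_exprD.
by congr (_ *m A ^+ _); lia.
Qed.

Lemma lim_addA : associative lim_add.
Proof.
move=> u v w; rewrite -[u]lim_reprK -[v]lim_reprK -[w]lim_reprK.
case: (repr u) (repr v) (repr w) => [x n] [y m] [z l].
rewrite !lim_class_add; congr (lim_class (_, _)); last by rewrite addnA.
rewrite !mulmxDl -!mulmx_exprD addrA.
by congr (_ *m A ^+ _ + _ *m A ^+ _ + _ *m A ^+ _); lia.
Qed.

Lemma lim_addC : commutative lim_add.
Proof. by move=> u v; rewrite /lim_add addrC addnC. Qed.

Lemma lim_add0 : left_id lim_zero lim_add.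
Proof.
move=> u; rewrite -[u]lim_reprK; case: (repr u) => x n.
by rewrite lim_class_add mul0mx add0r expr0 mulmx1.
Qed.

Lemma lim_addN : left_inverse lim_zero lim_opp lim_add.
Proof.
move=> u; rewrite -[u]lim_reprK; case: (repr u) => x n.
rewrite lim_class_opp lim_class_add mulNmx addNr.
by apply/eqP/lim_classP; exists 0%N; rewrite /= !mul0mx.
Qed.

HB.instance Definition _ :=
  GRing.isZmodule.Build lim_group lim_addA lim_addC lim_add0 lim_addN.

Definition lim_pos : set lim_group :=
  [set lim_class x |
    x in [set x : 'rV[int]_q * nat | forall j, 0 <= x.1 0 j]].

End matrix_limit.

Definition triple_iso (G H : zmodType) (Gpos : set G) (Hpos : set H)
    (S : G -> G) (T : H -> H) :=
  exists phi : {additive G -> H},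
    [/\ bijective phi, phi @` Gpos = Hpos & forall x, phi (S x) = T (phi x)].

Section unimodal_dimension.
Context {R : realType}.
Variables (tau : R -> R) (c : R).

Definition I1 : set R := gen_orbit tau (crit_partition c).

Definition disc_X := disconnection I1.

Definition sigma : disc_X -> disc_X := assoc_local_homeo tau.

Definition DG := dim_group sigma.
HB.instance Definition _ := GRing.Zmodule.on DG.
Definition DG_pos : set DG := dim_pos (sigma := sigma).
Definition DG_aut : DG -> DG := dim_transfer (sigma := sigma).

(* I(a, b), the class of the characteristic function of [a^+, b^-]_X *)
Definition DG_interval (a b : R) : DG := dim_indic sigma (dinterval I1 a b).

Definition monotonic_on (A : set R) :=
  {in A &, {homo tau : x y / x <= y}} \/ {in A &, {homo tau : x y /~ x <= y}}.

(* The partition is b 0 < ... < b q; other values of b are irrelevant. *)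
Definition markov_partition (q : nat) (b : nat -> R) :=
  [/\ [/\ b 0%N = 0, b q = 1 & forall i, (i < q)%N -> b i < b i.+1],
      forall i, (i <= q)%N -> I1 (b i),
      forall i, (i < q)%N -> monotonic_on `]b i, b i.+1[,
      forall i, (i < q)%N -> exists2 J : set nat, J `<=` `I_q &
        closure (tau @` `]b i, b i.+1[) = \bigcup_(j in J) [set` `[b j, b j.+1]] &
      exists k, iter k tau @` crit_partition c `<=` b @` `I_q.+1].

Definition markov_map := exists q b, markov_partition q b.

Definition incidence_matrix (q : nat) (b : nat -> R) : 'M[int]_q :=
  \matrix_(i, j) (`[< dinterval I1 (b j) (b j.+1) `<=`
                      sigma @` dinterval I1 (b i) (b i.+1) >] : nat)%:Z.

End unimodal_dimension.

Arguments DG {R} tau c.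
Arguments DG_pos {R} tau c.
Arguments DG_aut {R} tau c.
Arguments sigma {R} tau c.
Arguments lim_pos {q} A.
Arguments lim_aut {q} A.

(* Main.v *)
Require Import Defs.
From HB Require Import structures.
From mathcomp Require Import all_boot all_order all_algebra.
From mathcomp Require Import fraction.
From mathcomp Require Import finmap zify lra.
From mathcomp Require Import all_classical all_reals all_analysis.

Import Order.TTheory GRing.Theory Num.Theory.
Import numFieldNormedType.Exports.
Local Open Scope ring_scope.

Set Implicit Arguments.
Unset Strict Implicit.
Unset Printing Implicit Defensive.

(* For a in I_1 let e_a be the class of [a^+, 1]_X; these classes span
   C(X, Z), with e_0 = [1_X] and e_1 = 0.  The two branches of sigma are order
   isomorphisms of [0, c^-] and [c^+, 1] onto final segments of X (the second
   one reversing the order), hence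
     L e_a = e_{tau a} + e_{tau 1}  if a <= c,
     L e_a = e_{tau 1} - e_{tau a}  if a >= c.
   Consequently the set of a in I_1 with e_a in Z[t, t^-1][1_X] is closed under
   images and preimages by tau; it contains 0, c and 1, so it is all of I_1.
   If c is not eventually periodic, L^n e_0 = +- e_{x_n} + (terms e_{x_j}, j < n)
   where x_0 = 0 and the x_n, n > 0, form a tail of the orbit of c.  The x_n are
   distinct, and the jump functional f(x^+) - f(x^-) at x = x_n detects the
   leading term, so that [1_X] has no annihilator.
   If c is eventually periodic, the e_b with b in a Markov partition span an
   L-invariant group which absorbs every f after finitely many steps, and on
   which L acts as the incidence matrix in the basis of the intervals E_i. *)

(** * The disconnection *)

(** Surjectivity of tau enters through two facts only: tau c = 1, and tau 0 = 0 or tau 1 = 0. By the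
    second, one branch of sigma is onto X, so L has a section preserving positivity: this makes
    [DG_aut] onto, and it lifts positive elements of the matrix limit to nonnegative functions. The
    same fact controls e_{tau 1}, the term common to both formulas for L e_a: either tau 1 = 0 and
    it is e_0, or tau 0 = 0 and it is L e_0 - e_0. Going from e_a to e_{tau a} only inverts a sign;
    going back requires t to be invertible. The obstacle is that sigma is specified by continuity
    and by its values over undoubled points. It is therefore identified with an explicit map
    [sigma_def], which records the side of tau x on which each side of x lands; uniqueness holds
    because I_1 is countable, so that undoubled points are dense. After that, every statement on L
    reduces to how the two branches move the cuts [above a]. *)

Section Disconnection.
Local Open Scope classical_set_scope.
Context {R : realType}.
Variable S : set R.
Notation X := (disconnection S).
Implicit Types (a b : R) (x y z : X).

Definition doubled a := a \in S `\` [set 0; 1].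

Definition upper x : bool := (dpoint_val x).2.

(* a^+ if [u] and a is doubled, a^- otherwise. *)
Definition mkpt a (u : bool) : X :=
  insubd (dpoint1 S) ((a, u && doubled a) : R *l bool).

(* For a in S this is a^+ <= x, except that nothing is above 1. *)
Definition above a x : bool :=
  (a < collapse x) || ((a == collapse x) && (upper x || (a == 0))).

Lemma doubledE a : doubled a = [&& `[< S a >], a != 0 & a != 1].
Proof.
rewrite /doubled; apply/idP/idP.
  rewrite inE => -[Sa /= /not_orP[/eqP a0 /eqP a1]].
  by apply/and3P; split=> //; apply/asboolP.
move=> /and3P[/asboolP Sa a0 a1]; rewrite inE; split=> //=.
by move=> -[] /eqP; apply/negP.
Qed.

Lemma collapse_itv x : 0 <= collapse x <= 1.
Proof.
case: x => -[a u] h; rewrite /collapse /=.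
by have /andP[] := h; rewrite /= in_itv.
Qed.

Lemma upper_doubled x : upper x -> doubled (collapse x).
Proof.
by case: x => -[a u] h; rewrite /collapse /upper /=; have /andP[_ /implyP] := h.
Qed.

Lemma mkptK a u : 0 <= a <= 1 ->
  dpoint_val (mkpt a u) = (a, u && doubled a) :> (R *l bool).
Proof.
move=> a01; rewrite /mkpt; apply: insubdK.
rewrite unfold_in /dpoint_pred /= in_itv /= a01 /=.
by apply/implyP => /andP[].
Qed.

Lemma collapse_mkpt a u : 0 <= a <= 1 -> collapse (mkpt a u) = a.
Proof. by move=> /mkptK e; rewrite /collapse e. Qed.

Lemma upper_mkpt a u : 0 <= a <= 1 -> upper (mkpt a u) = u && doubled a.
Proof. by move=> /mkptK e; rewrite /upper e. Qed.

Lemma disc_eq x y : collapse x = collapse y -> upper x = upper y -> x = y.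
Proof.
move=> cxy uxy; apply: val_inj => /=.
case: x y cxy uxy => -[a u] hx [[b v] hy].
by rewrite /collapse /upper /= => -> ->.
Qed.

Lemma mkpt_collapse x : mkpt (collapse x) (upper x) = x.
Proof.
have x01 := collapse_itv x.
apply: disc_eq; rewrite ?collapse_mkpt// upper_mkpt//.
by case: (boolP (upper x)) => // /upper_doubled.
Qed.

Lemma disc_leE x y : (x <= y)%O =
  (collapse x < collapse y) || ((collapse x == collapse y) && (upper x ==> upper y)).
Proof.
have -> : (x <= y)%O = (dpoint_val x <= dpoint_val y)%O by [].
rewrite Order.ProdLexiOrder.leEprodlexi /collapse /upper.
case: (dpoint_val x) (dpoint_val y) => a u [b v] /=.
by case: ltgtP => //= _; case: u; case: v.
Qed.

Lemma disc_ltE x y : (x < y)%O =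
  (collapse x < collapse y) || ((collapse x == collapse y) && (~~ upper x && upper y)).
Proof.
rewrite ltNge disc_leE; case: ltgtP => //= _.
by case: (upper x); case: (upper y).
Qed.

Hypothesis S01 : forall a, S a -> 0 <= a <= 1.
Hypothesis S0 : S 0.

Lemma doubled_itv a : doubled a -> 0 < a < 1.
Proof.
rewrite doubledE => /and3P[/asboolP/S01/andP[a0 a1] n0 n1].
by rewrite !lt_neqAle a0 a1 n1 eq_sym n0.
Qed.

Lemma doubled_itvW a : doubled a -> 0 <= a <= 1.
Proof. by move=> /doubled_itv /andP[a0 a1]; rewrite !ltW. Qed.

Lemma doubled_cases a : S a -> [\/ a = 0, a = 1 | doubled a].
Proof.
move=> Sa; have [->|a0] := eqVneq a 0; first exact: Or31.
have [->|a1] := eqVneq a 1; first exact: Or32.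
by apply: Or33; rewrite doubledE a0 a1 !andbT; apply/asboolP.
Qed.

Lemma above0 x : above 0 x.
Proof.
rewrite /above eqxx orbT andbT orbC -le_eqVlt.
by case/andP: (collapse_itv x).
Qed.

(** 1 is not doubled, so no point over it is [upper]; this is what makes e_1 = 0. *)
Lemma above1 x : above 1 x = false.
Proof.
rewrite /above oner_eq0 orbF; have /andP[_ x1] := collapse_itv x.
rewrite ltNge x1 /=; apply/negP => /andP[/eqP e /upper_doubled].
by rewrite -e => /doubled_itv; rewrite ltxx andbF.
Qed.

Lemma above_doubled a x : doubled a -> above a x = (mkpt a false < x)%O.
Proof.
move=> da; have a01 := doubled_itvW da; have /andP[/lt0r_neq0 a0 _] := doubled_itv da.
by rewrite disc_ltE collapse_mkpt// upper_mkpt//= /above (negbTE a0) orbF.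
Qed.

Lemma above_doubledN a x : doubled a -> ~~ above a x = (x < mkpt a true)%O.
Proof.
move=> da; have a01 := doubled_itvW da; have /andP[/lt0r_neq0 a0 _] := doubled_itv da.
rewrite disc_ltE collapse_mkpt// upper_mkpt//= /above (negbTE a0) orbF da andbT.
by case: ltgtP.
Qed.

(** Cuts are clopen: for a doubled, [above a] is the open ray to the right of a^- and its negation
    the open ray to the left of a^+. At 0 and 1 the cut is constant. *)
Lemma above_near a x : S a -> \forall y \near x, above a y = above a x.
Proof.
move=> /doubled_cases[->|->|da].
- by apply: filterE => y; rewrite !above0.
- by apply: filterE => y; rewrite !above1.
case: (boolP (above a x)) => h.
- apply: filterS (open_nbhs_nbhs (conj (@rray_open _ X (mkpt a false)) _)).
    by move=> y /=; rewrite in_itv /= andbT above_doubled.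
  by rewrite /= in_itv /= andbT -above_doubled.
- apply: filterS (open_nbhs_nbhs (conj (@lray_open _ X (mkpt a true)) _)).
    by move=> y /=; rewrite in_itv /= -above_doubledN// => /negbTE.
  by rewrite /= in_itv /= -above_doubledN.
Qed.

(** This and the next lemma turn neighbourhoods in X into one-sided intervals of R. Points over a
    itself are left out, so that doubled and undoubled a are treated alike. *)
Lemma nbhs_lower a (U : set X) : 0 < a <= 1 -> nbhs (mkpt a false) U ->
  exists b, [/\ 0 <= b, b < a & forall y, b < collapse y < a -> U y].
Proof.
move=> /andP[a0 a1]; have a01 : 0 <= a <= 1 by rewrite ltW.
rewrite itv_nbhsE => -[i [oi ai] iU].
have up y : collapse y < a -> (y < mkpt a false)%O.
  by move=> ya; rewrite disc_ltE collapse_mkpt// ya.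
have dn z : (z < mkpt a false)%O -> collapse z < a.
  by rewrite disc_ltE collapse_mkpt// upper_mkpt// !andbF orbF.
case: i oi ai iU => -[[] u|[]] [[] v|[]]//= _; rewrite in_itv /= ?andbT.
- move=> /andP[ua av] iU; exists (collapse u); have /andP[u0 _] := collapse_itv u.
  split=> // [|y /andP[uy ya]]; first exact: dn.
  apply: iU; rewrite /= in_itv /= (lt_trans _ av) ?up// andbT.
  by rewrite disc_ltE uy.
- move=> ua iU; exists (collapse u); have /andP[u0 _] := collapse_itv u.
  split=> // [|y /andP[uy ya]]; first exact: dn.
  by apply: iU; rewrite /= in_itv /= andbT disc_ltE uy.
- move=> av iU; exists 0; split=> // y /andP[_ ya].
  by apply: iU; rewrite /= in_itv /= (lt_trans _ av) ?up.
- by move=> _ iU; exists 0; split=> // y _; apply: iU.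
Qed.

Lemma nbhs_upper a (U : set X) : 0 <= a < 1 ->
  nbhs (mkpt a true) U ->
  exists b, [/\ a < b, b <= 1 & forall y, a < collapse y < b -> U y].
Proof.
move=> /andP[a0 a1]; have a01 : 0 <= a <= 1 by rewrite a0 ltW.
rewrite itv_nbhsE => -[i [oi ai] iU].
have up y : a < collapse y -> (mkpt a true < y)%O.
  by move=> ya; rewrite disc_ltE collapse_mkpt// ya.
have dn z : (mkpt a true < z)%O -> a < collapse z.
  rewrite disc_ltE collapse_mkpt// upper_mkpt//=.
  case: ltgtP => //= e /andP[+ /upper_doubled]; rewrite -e => /negP + h; exact.
case: i oi ai iU => -[[] u|[]] [[] v|[]]//= _; rewrite in_itv /= ?andbT.
- move=> /andP[ua av] iU; exists (collapse v); have /andP[_ v1] := collapse_itv v.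
  split=> // [|y /andP[ay yv]]; first exact: dn.
  apply: iU; rewrite /= in_itv /= (lt_trans ua) ?up//=.
  by rewrite disc_ltE yv.
- move=> ua iU; exists 1; split=> // y /andP[ay _].
  by apply: iU; rewrite /= in_itv /= andbT (lt_trans ua) ?up.
- move=> av iU; exists (collapse v); have /andP[_ v1] := collapse_itv v.
  split=> // [|y /andP[ay yv]]; first exact: dn.
  by apply: iU; rewrite /= in_itv /= disc_ltE yv.
- by move=> _ iU; exists 1; split=> // y _; apply: iU.
Qed.

(** Every neighbourhood in X contains all points over some real interval on one side, and such an
    interval is not contained in the countable set [S]. *)
Lemma dense_undoubled : countable S -> dense [set x : X | ~ S (collapse x)].
Proof.
move=> cS U [x Ux] oU.
(* An interval inside [S] would be countable, hence of Lebesgue measure zero. *)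
have gap r s : r < s -> exists2 t, r < t < s & ~ S t.
  move=> rs; apply: contrapT => h.
  have sub : `]r, s[%classic `<=` S.
    move=> t /=; rewrite in_itv /= => ht; apply: contrapT => nS; apply: h.
    by exists t.
  have := countable_lebesgue_measure0 (sub_countable (subset_card_le sub) cS).
  rewrite lebesgue_measure_itv /= lte_fin rs -EFinB => -[] /eqP.
  by rewrite subr_eq0 => /eqP e; move: rs; rewrite e ltxx.
have nU : nbhs x U by exact: open_nbhs_nbhs.
have fin t : ~ S t -> 0 <= t <= 1 -> (forall y, collapse y = t -> U y) ->
    U `&` [set x | ~ S (collapse x)] !=set0.
  move=> nS t01 h; exists (mkpt t false); split; first by apply: h; rewrite collapse_mkpt.
  by rewrite /= collapse_mkpt.
have /andP[x0 x1] := collapse_itv x.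
have [u|u] := boolP (upper x).
- have d := upper_doubled u; have /andP[d0 d1] := doubled_itv d.
  have [||b [xb b1 bU]] := @nbhs_upper (collapse x) U.
  + by rewrite x0.
  + by rewrite -u mkpt_collapse.
  have [t /andP[t1 t2] nS] := gap _ _ xb.
  apply: (fin t nS); first by rewrite (ltW (le_lt_trans x0 t1)) (ltW (lt_le_trans t2 b1)).
  by move=> y e; apply: bU; rewrite e t1.
- have e : x = mkpt (collapse x) false by rewrite -(negbTE u) mkpt_collapse.
  (* 0 can only be approached from the right; not being doubled, it is also [mkpt 0 true]. *)
  have [c0|c0] := eqVneq (collapse x) 0.
    have [||b [xb b1 bU]] := @nbhs_upper (collapse x) U.
    + by rewrite c0 lexx ltr01.
    + suff -> : mkpt (collapse x) true = x by [].
      apply: disc_eq; rewrite ?collapse_mkpt ?x0// upper_mkpt ?x0//=.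
      by rewrite (negbTE u) doubledE c0 eqxx andbF.
    have [t /andP[t1 t2] nS] := gap _ _ xb.
    apply: (fin t nS); first by rewrite (ltW (le_lt_trans x0 t1)) (ltW (lt_le_trans t2 b1)).
    by move=> y ye; apply: bU; rewrite ye t1.
  have [||b [b0 bx bU]] := @nbhs_lower (collapse x) U.
  + by rewrite lt_neqAle eq_sym c0 x0.
  + by rewrite -e.
  have [t /andP[t1 t2] nS] := gap _ _ bx.
  apply: (fin t nS); first by rewrite (ltW (le_lt_trans b0 t1)) (ltW (lt_le_trans t2 x1)).
  by move=> y ye; apply: bU; rewrite ye t1.
Qed.

Lemma eq_continuous_undoubled (f g : X -> X) : countable S ->
  continuous f -> continuous g ->
  (forall x, ~ S (collapse x) -> f x = g x) -> f = g.
Proof.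
move=> cS fC gC fg; apply/funext => x; apply: contrapT => /eqP nfg.
have := @order_hausdorff _ X.
rewrite open_hausdorff => /(_ _ _ nfg)[[A B] [/= fA gB] [oA oB /eqP AB]].
have [||y [[Ay By] ny]] := @dense_undoubled cS (f @^-1` A `&` g @^-1` B).
- by exists x; split=> /=; rewrite -inE.
- by apply: openI; [move/continuousP: fC; apply|move/continuousP: gC; apply].
- have : (A `&` B) (f y) by split=> //; rewrite fg.
  by rewrite AB.
Qed.

(** * Cuts and their integer combinations *)

Definition cut_fun a (x : X) : int := (above a x)%:R.

Lemma cut_fun_cont a : S a -> cut_fun a \in @cont_int_pred X.
Proof.
move=> Sa; apply/cont_intP => x; apply: filterS (above_near x Sa) => y.
by rewrite /cut_fun => ->.
Qed.

Definition cut_sum (s : seq (R * int)) (x : X) : int :=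
  \sum_(p <- s) p.2 * cut_fun p.1 x.

Lemma cut_fun_lt a x : collapse x < a -> cut_fun a x = 0.
Proof. by move=> xa; rewrite /cut_fun /above ltNge (ltW xa) /= gt_eqF. Qed.

Lemma cut_fun_gt a x : a < collapse x -> cut_fun a x = 1.
Proof. by move=> xa; rewrite /cut_fun /above xa. Qed.

(* The supremum t of the r such that f is a sum of cuts on [0, r) is 1: cuts are
   only made below r, so that near t such a sum and f are both constant on the
   left of t, and one more cut at t extends the representation beyond t. *)
Lemma cut_sum_rep (f : X -> int) : f \in @cont_int_pred X ->
  exists2 s : seq (R * int), {in s, forall p, S p.1} & f = cut_sum s.
Proof.
move=> /cont_intP fC.
pose Q r := exists2 s : seq (R * int), {in s, forall p, S p.1 /\ p.1 < r} &
  forall x, collapse x < r -> f x = cut_sum s x.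
pose E := [set r : R | 0 <= r <= 1 /\ Q r].
have E0 : E 0.
  split; first by rewrite lexx ler01.
  exists [::] => // x; have /andP[x0 _] := collapse_itv x.
  by rewrite ltNge x0.
have Eub : ubound E 1 by move=> r [/andP[]].
have hE : has_sup E by split; [exists 0|exists 1].
pose t := sup E.
have t0 : 0 <= t by apply: ub_le_sup => //; case: hE.
have t1 : t <= 1 by apply: ge_sup => //; exists 0.
have t01 : 0 <= t <= 1 by rewrite t0.
have cst s r x y : {in s, forall p : R * int, S p.1 /\ p.1 < r} ->
   r <= collapse x -> r <= collapse y -> cut_sum s x = cut_sum s y.
  move=> hs rx ry; apply: eq_big_seq => p /hs[_ pr].
  by rewrite !cut_fun_gt// (lt_le_trans pr).
(* The representation reaches t^- itself, so that only a change of value between t^- and t^+ is left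
   to treat. *)
have [s hs sf] : exists2 s : seq (R * int), {in s, forall p, S p.1 /\ p.1 < t} &
  forall x, collapse x < t \/ (0 < t /\ x = mkpt t false) -> f x = cut_sum s x.
  have [t00|tn0] := eqVneq t 0.
    exists [::] => // x [|[]]; rewrite t00 ?ltxx//.
    by have /andP[x0 _] := collapse_itv x; rewrite ltNge x0.
  have tp : 0 < t by rewrite lt_neqAle eq_sym tn0.
  have [|b [b0 bt bU]] := nbhs_lower _ (fC (mkpt t false)); first by rewrite tp.
  have bt' : 0 < t - b by rewrite subr_gt0.
  have [r [/andP[r0 r1] [s hs sf]]] := sup_adherent bt' hE.
  rewrite -/t opprB addrCA subrr addr0 => br.
  have rt : r <= t.
    by apply: ub_le_sup; [exact: (proj2 hE)|split=> //; rewrite ?r0//; exists s].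
  (* [m] is the last cut, or [b] if that is larger: at a point w of (m, r) both [f] and the sum
     already have the value they keep up to t^-. *)
  pose m := \big[Num.max/b]_(p <- s) p.1.
  have mr : m < r.
    rewrite /m; elim: (s) hs => [|p l ih] h; first by rewrite big_nil.
    rewrite big_cons gt_max (proj2 (h p _)) ?mem_head//=.
    by apply: ih => q ql; apply: h; rewrite in_cons ql orbT.
  have bm : b <= m.
    by rewrite /m; elim: (s) => [|p l ih]; rewrite ?big_nil// big_cons le_max ih orbT.
  have sm p : p \in s -> p.1 <= m.
    rewrite /m; elim: (s) => // q l ih; rewrite in_cons big_cons le_max.
    by move=> /predU1P[->|/ih ->]; rewrite ?lexx// orbT.
  pose w := (m + r) / 2.
  have mw : m < w by rewrite /w; lra.
  have wr : w < r by rewrite /w; lra.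
  have w01 : 0 <= w <= 1 by apply/andP; split; lra.
  have cw x : m < collapse x -> cut_sum s x = cut_sum s (mkpt w false).
    move=> mx; apply: eq_big_seq => p /sm pm.
    by rewrite !cut_fun_gt ?collapse_mkpt// (le_lt_trans pm).
  have fw : f (mkpt w false) = f (mkpt t false).
    by apply: bU; rewrite collapse_mkpt//; apply/andP; split; lra.
  have sw : f (mkpt w false) = cut_sum s (mkpt w false) by apply: sf; rewrite collapse_mkpt.
  exists s => [p /hs[Sp pr]|x [xt|[_ ->]]]; first by split=> //; apply: lt_le_trans rt.
    have [xr|rx] := ltP (collapse x) r; first exact: sf.
    rewrite (bU x); last by rewrite xt andbT (lt_le_trans br).
    by rewrite -fw sw cw// (lt_le_trans mr).
  by rewrite -fw sw cw// collapse_mkpt//; lra.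
have [t1e|tn1] := eqVneq t 1.
  exists s => [p /hs[]//|]; apply/funext => x; apply: sf.
  have /andP[x0 x1] := collapse_itv x.
  have [xt|tx] := ltP (collapse x) t; [by left|right].
  have xe : collapse x = 1 by apply/eqP; rewrite eq_le x1 -t1e tx.
  have o01 : 0 <= (1 : R) <= 1 by rewrite ler01 lexx.
  rewrite t1e ltr01; split=> //; apply: disc_eq; rewrite ?collapse_mkpt//.
  rewrite upper_mkpt//=; apply/negP => /upper_doubled.
  by rewrite xe => /doubled_itv; rewrite ltxx andbF.
have tl1 : t < 1 by rewrite lt_neqAle tn1.
have [|b [tb b1 bU]] := nbhs_upper _ (fC (mkpt t true)); first by rewrite t0.
(* As t < b, this contradicts the choice of t as a supremum. *)
suff : Q b.
  move=> Qb; have : b <= t.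
    by apply: ub_le_sup; [exact: (proj2 hE)|split=> //; rewrite b1 andbT; lra].
  by rewrite leNgt tb.
have above_t x : collapse x < b -> ~ (collapse x < t \/ (0 < t /\ x = mkpt t false)) ->
    f x = f (mkpt t true).
  move=> xb nx; have [tx|xt] := ltP t (collapse x); first by apply: bU; rewrite tx.
  have xe : collapse x = t.
    by apply/eqP; rewrite eq_le xt leNgt; apply/negP => h; apply: nx; left.
  congr f; apply: disc_eq; rewrite ?collapse_mkpt// upper_mkpt//=.
  case: (boolP (upper x)) => [/upper_doubled|ux]; first by rewrite xe => ->.
  apply/esym/negbTE/negP => dt; apply: nx; right.
  have /andP[tp _] := doubled_itv dt; split=> //.
  by apply: disc_eq; rewrite ?collapse_mkpt// upper_mkpt// (negbTE ux).
have [St|nSt] := pselect (S t).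
  (* The jump of [f] at t, which is the coefficient of the new cut. *)
  pose a := f (mkpt t true) - cut_sum s (mkpt t true).
  have cutt x : collapse x < t \/ (0 < t /\ x = mkpt t false) -> cut_fun t x = 0.
    move=> [|[tp ->]]; first exact: cut_fun_lt.
    by rewrite /cut_fun /above collapse_mkpt// ltxx eqxx upper_mkpt//= gt_eqF.
  exists ((t, a) :: s) => [p|x xb].
    rewrite in_cons => /predU1P[->//|/hs[? pt]]; split=> //.
    exact: lt_trans tb.
  rewrite /cut_sum big_cons -/(cut_sum s x) /=.
  have [h|h] := pselect (collapse x < t \/ (0 < t /\ x = mkpt t false)).
    by rewrite cutt// mulr0 add0r sf.
  rewrite (above_t x)// (cst s t x (mkpt t true))//; last by rewrite collapse_mkpt.
    suff -> : cut_fun t x = 1 by rewrite mulr1 subrK.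
    rewrite /cut_fun; suff -> : above t x by [].
    rewrite /above; case: ltgtP => //= [xt|xe]; first by case: h; left.
    have [//|tn0] := eqVneq t 0; first by rewrite orbT.
    rewrite orbF; apply/negPn/negP => ux; apply: h; right; split.
      by rewrite lt_neqAle eq_sym tn0.
    by apply: disc_eq; rewrite ?collapse_mkpt// upper_mkpt// (negbTE ux).
  by rewrite leNgt; apply/negP => xt; apply: h; left.
(* Here t is not doubled: t^+ = t^-, and the old sum remains valid beyond t. *)
have tp : 0 < t by rewrite lt_neqAle t0 andbT; apply/negP => /eqP e; apply: nSt; rewrite -e.
have fe : mkpt t true = mkpt t false.
  apply: disc_eq; rewrite ?collapse_mkpt// !upper_mkpt//= doubledE.
  by apply/negP => /andP[/asboolP].
exists s => [p /hs[? pt]|x xb]; first by split=> //; apply: lt_trans tb.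
have [h|h] := pselect (collapse x < t \/ (0 < t /\ x = mkpt t false)); first exact: sf.
rewrite above_t// (cst s t x (mkpt t false)) ?collapse_mkpt//.
  by rewrite fe; apply: sf; right.
by rewrite leNgt; apply/negP => xt; apply: h; left.
Qed.
End Disconnection.

(** * The generalized orbit *)

Section GeneralizedOrbit.
Local Open Scope classical_set_scope.
Context {R : realType}.
Variables (tau : R -> R) (c : R).
Hypothesis tau_unimodal : unimodal tau c.
Notation S := (I1 tau c).
Implicit Types (a b x y : R).

Let c01 : 0 < c < 1. Proof. by case: tau_unimodal. Qed.

Lemma tau_itv x : 0 <= x <= 1 -> 0 <= tau x <= 1.
Proof.
case: tau_unimodal => _ h _ _ _ x01; have /= := h x.
by rewrite !in_itv /= x01 => /(_ isT).
Qed.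

Lemma tau_incr x y : 0 <= x -> x < y -> y <= c -> tau x < tau y.
Proof.
case: tau_unimodal => _ _ _ h _ x0 xy yc; apply: h => //; rewrite in_itv /=.
  by rewrite x0 (ltW (lt_le_trans xy yc)).
by rewrite yc (ltW (le_lt_trans x0 xy)).
Qed.

Lemma tau_decr x y : c <= x -> x < y -> y <= 1 -> tau y < tau x.
Proof.
case: tau_unimodal => _ _ _ _ h cx xy y1; apply: h => //; rewrite in_itv /=.
  by rewrite y1 (ltW (le_lt_trans cx xy)).
by rewrite cx (ltW (lt_le_trans xy y1)).
Qed.

Lemma gen_orbit_itv x : S x -> 0 <= x <= 1.
Proof.
move=> /(_ `[0, 1]); rewrite /= in_itv; apply; split.
  split=> // y /=; rewrite in_itv; exact: tau_itv.
case/andP: c01 => c0 c1 y [[->|->]|->] /=; rewrite in_itv /= ?lexx ?ler01//.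
by rewrite !ltW.
Qed.

Lemma gen_orbit_crit x : crit_partition c x -> S x.
Proof. by move=> cx M [_]; apply. Qed.

Lemma gen_orbit0 : S 0. Proof. by apply: gen_orbit_crit; left; left. Qed.
Lemma gen_orbitc : S c. Proof. by apply: gen_orbit_crit; left; right. Qed.
Lemma gen_orbit1 : S 1. Proof. by apply: gen_orbit_crit; right. Qed.

Lemma gen_orbit_tau x : S x -> S (tau x).
Proof. by move=> Sx M MM; have [[_ h _] _] := MM; apply: h; exact: Sx. Qed.

Lemma gen_orbit_preim x : 0 <= x <= 1 -> S (tau x) -> S x.
Proof.
move=> x01 Sx M MM; have [[_ _ h] _] := MM; apply: h; last exact: Sx.
by rewrite in_itv.
Qed.

(** Induction principle on I_1. [M] may contain points outside [0, 1], which [fully_invariant]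
    forbids; hence the intersection in the proof. *)
Lemma gen_orbit_min (M : set R) :
  (forall x, M x -> M (tau x)) ->
  (forall x, 0 <= x <= 1 -> M (tau x) -> M x) ->
  crit_partition c `<=` M -> forall x, S x -> M x.
Proof.
move=> M1 M2 M3 x /(_ (M `&` `[0, 1])) h; suff [] : (M `&` `[0, 1]) x by [].
apply: h; split; last first.
  move=> y Cy; split; first exact: M3.
  by rewrite /= in_itv; apply: gen_orbit_itv; exact: gen_orbit_crit.
split=> [y []//|y [My /=]|y].
  by rewrite in_itv => y01; split; [exact: M1|rewrite /= in_itv; exact: tau_itv].
by rewrite in_itv => y01 [My _]; split; [exact: M2|rewrite /= in_itv].
Qed.

Lemma tau_inj_left x y : 0 <= x <= c -> 0 <= y <= c -> tau x = tau y -> x = y.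
Proof.
move=> /andP[x0 xc] /andP[y0 yc] e; case: (ltgtP x y) => // h.
  by have := tau_incr x0 h yc; rewrite e ltxx.
by have := tau_incr y0 h xc; rewrite e ltxx.
Qed.

Lemma tau_inj_right x y : c <= x <= 1 -> c <= y <= 1 -> tau x = tau y -> x = y.
Proof.
move=> /andP[x0 xc] /andP[y0 yc] e; case: (ltgtP x y) => // h.
  by have := tau_decr x0 h yc; rewrite e ltxx.
by have := tau_decr y0 h xc; rewrite e ltxx.
Qed.

(** tau is injective on each side of c, so an injection of [M] into nat pulls back to each of the
    two halves of the preimage. *)
Lemma countable_preim (M : set R) : countable M ->
  countable [set x | 0 <= x <= 1 /\ M (tau x)].
Proof.
move=> /countable_injP[f fi].
have -> : [set x | 0 <= x <= 1 /\ M (tau x)] =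
    [set x | 0 <= x <= c /\ M (tau x)] `|` [set x | c <= x <= 1 /\ M (tau x)].
  have /andP[c0 c1] := c01.
  apply/seteqP; split=> x /=.
    move=> [/andP[x0 x1] Mx]; have [xc|cx] := leP x c; first by left; rewrite x0.
    by right; rewrite (ltW cx) x1.
  move=> [[/andP[-> h] Mx]|[/andP[h ->] Mx]].
    by rewrite (le_trans h (ltW c1)).
  by rewrite (le_trans (ltW c0) h).
rewrite -bigcup2E; apply: bigcup_countable => // -[|[|i]] _ /=; last exact: countable0.
- apply/countable_injP; exists (f \o tau) => x y; rewrite !inE /= => -[hx Mx] [hy My].
  by move=> /(fi _ _); rewrite !inE => /(_ Mx My); apply: tau_inj_left.
- apply/countable_injP; exists (f \o tau) => x y; rewrite !inE /= => -[hx Mx] [hy My].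
  by move=> /(fi _ _); rewrite !inE => /(_ Mx My); apply: tau_inj_right.
Qed.

(** I_1 lies in the union of the iterated preimages of the forward orbits of C. *)
Lemma gen_orbit_countable : countable S.
Proof.
pose O := \bigcup_m (iter m tau @` crit_partition c).
have cO : countable O.
  apply: bigcup_countable => // m _.
  apply: (sub_countable (card_image_le _ _)); apply: finite_set_countable.
  by rewrite /crit_partition; do !rewrite finite_setU; split; [split|]; exact: finite_set1.
pose P n := [set x | 0 <= x <= 1 /\ O (iter n tau x)].
have cP n : countable (P n).
  elim: n => [|n /countable_preim].
    by apply: sub_countable cO; apply: subset_card_le => x [].
  apply: sub_countable; apply: subset_card_le => x [x01 h].
  by split=> //; split; [exact: tau_itv|rewrite -iterSr].
apply: (@sub_countable _ _ _ (\bigcup_n P n)); last exact: bigcup_countable.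
apply: subset_card_le; apply: gen_orbit_min.
- move=> x [n _ [x01 [m _ [y Cy e]]]]; exists n => //; split; first exact: tau_itv.
  by exists m.+1 => //; exists y => //; rewrite iterS e -iterSr.
- move=> x x01 [n _ [_ h]]; exists n.+1 => //; split=> //.
  by rewrite iterSr.
- move=> x Cx; exists 0%N => //; split; first by apply: gen_orbit_itv; exact: gen_orbit_crit.
  by exists 0%N => //; exists x.
Qed.

Hypothesis tau_surj : surjective_on_I tau.

(** The value 1 is attained, and the strict maximum of tau is at c. *)
Lemma tau_crit : tau c = 1.
Proof.
have /andP[c0 c1] := c01.
have [|x] := @tau_surj 1; first by rewrite /= in_itv /= ler01 lexx.
rewrite /= in_itv /= => /andP[x0 x1] tx.
have /andP[_ tc1] : 0 <= tau c <= 1 by apply: tau_itv; rewrite !ltW.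
case: (ltgtP x c) => [xc|cx|<-//].
  by have := tau_incr x0 xc (lexx _); rewrite tx ltNge tc1.
by have := tau_decr (lexx _) cx x1; rewrite tx ltNge tc1.
Qed.

(** The value 0 is attained, and a unimodal map takes its minimum at an end of I. *)
Lemma tau_ends : tau 0 = 0 \/ tau 1 = 0.
Proof.
have /andP[c0 c1] := c01.
have [|x] := @tau_surj 0; first by rewrite /= in_itv /= ler01 lexx.
rewrite /= in_itv /= => /andP[x0 x1] tx.
have /andP[t0 _] : 0 <= tau 0 <= 1 by apply: tau_itv; rewrite lexx ler01.
have /andP[t1 _] : 0 <= tau 1 <= 1 by apply: tau_itv; rewrite lexx ler01.
have [xc|cx] := leP x c; [left|right].
  have [x00|n0] := eqVneq x 0; first by rewrite x00 in tx.
  have : tau 0 < tau x by apply: tau_incr => //; rewrite lt_neqAle eq_sym n0.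
  by rewrite tx ltNge t0.
have [x11|n1] := eqVneq x 1; first by rewrite x11 in tx.
have : tau 1 < tau x by apply: tau_decr => //; rewrite ?ltW// lt_neqAle n1.
by rewrite tx ltNge t1.
Qed.

Lemma tau_cont : {within `[0, 1], continuous tau}.
Proof. by case: tau_unimodal. Qed.

Lemma ivt_left v : tau 0 <= v <= 1 -> exists2 x, 0 <= x <= c & tau x = v.
Proof.
have /andP[c0 c1] := c01; move=> /andP[v0 v1].
have [|||x] := @IVT R tau 0 c v; first exact: ltW.
- apply: continuous_subspaceW tau_cont => x /=; rewrite !in_itv /= => /andP[-> h].
  by rewrite (le_trans h (ltW c1)).
- by rewrite tau_crit ge_min v0 le_max v1 orbT.
- by rewrite in_itv; exists x.
Qed.

Lemma ivt_right v : tau 1 <= v <= 1 -> exists2 x, c <= x <= 1 & tau x = v.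
Proof.
have /andP[c0 c1] := c01; move=> /andP[v0 v1].
have [|||x] := @IVT R tau c 1 v; first exact: ltW.
- apply: continuous_subspaceW tau_cont => x /=; rewrite !in_itv /= => /andP[h ->].
  by rewrite (le_trans (ltW c0) h).
- by rewrite tau_crit ge_min v0 orbT le_max v1.
- by rewrite in_itv; exists x.
Qed.

End GeneralizedOrbit.

(** * The local homeomorphism *)

Section SigmaMap.
Local Open Scope classical_set_scope.
Context {R : realType}.
Variables (tau : R -> R) (c : R).
Hypothesis tau_unimodal : unimodal tau c.
Hypothesis tau_surj : surjective_on_I tau.
Notation S := (I1 tau c).
Notation X := (disconnection S).
Implicit Types (a b : R) (x y z : X).

Let c01 : 0 < c < 1. Proof. by case: tau_unimodal. Qed.
Let S01 := gen_orbit_itv tau_unimodal.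
Let S0 : S 0 := @gen_orbit0 _ tau c.
Let Sc : S c := @gen_orbitc _ tau c.
Let S1 : S 1 := @gen_orbit1 _ tau c.
Let tauc := tau_crit tau_unimodal tau_surj.

(* Tells x^+ from x^-, with 0 counted as 0^+ and 1 as 1^-. *)
Definition side x : bool := upper x || (collapse x == 0).

(** tau reverses the order to the right of c and thus exchanges the two sides of a point there,
    hence the exclusive or. [mkpt] forgets the side when the image point is not doubled. *)
Definition sigma_def x : X :=
  mkpt S (tau (collapse x)) (above c x (+) side x).

Lemma aboveE a x : above a x = (a < collapse x) || ((a == collapse x) && side x).
Proof. by rewrite /above /side; case: eqVneq => [->|]. Qed.

Let tau01 x : 0 <= tau (collapse x) <= 1.
Proof. exact: (tau_itv tau_unimodal (collapse_itv x)). Qed.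

Lemma collapse_sigma_def x : collapse (sigma_def x) = tau (collapse x).
Proof. exact: collapse_mkpt. Qed.

Lemma upper_sigma_def x :
  upper (sigma_def x) = (above c x (+) side x) && doubled S (tau (collapse x)).
Proof. exact: upper_mkpt. Qed.

Lemma tau_lt_left a b : 0 <= a <= c -> 0 <= b <= c -> (tau a < tau b) = (a < b).
Proof.
move=> /andP[a0 ac] /andP[b0 bc]; case: (ltgtP a b) => [ab|ba|->]; last by rewrite ltxx.
  by rewrite (tau_incr tau_unimodal).
by apply/negbTE; rewrite -leNgt ltW// (tau_incr tau_unimodal).
Qed.

Lemma tau_lt_right a b : c <= a <= 1 -> c <= b <= 1 -> (tau a < tau b) = (b < a).
Proof.
move=> /andP[a0 ac] /andP[b0 bc]; case: (ltgtP a b) => [ab|ba|->]; last by rewrite ltxx.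
  by apply/negbTE; rewrite -leNgt ltW// (tau_decr tau_unimodal).
by rewrite (tau_decr tau_unimodal).
Qed.

Lemma left_itv x : ~~ above c x -> 0 <= collapse x <= c.
Proof.
rewrite aboveE negb_or -leNgt => /andP[-> _]; rewrite andbT.
by case/andP: (collapse_itv x).
Qed.

Lemma right_itv x : above c x -> c <= collapse x <= 1.
Proof.
rewrite aboveE => h; have /andP[_ ->] := collapse_itv x; rewrite andbT.
by rewrite le_eqVlt; case/orP: h => [->|/andP[-> _]//]; rewrite orbT.
Qed.

Lemma side0 x : collapse x = 0 -> side x.
Proof. by rewrite /side orbC => ->; rewrite eqxx. Qed.

Lemma side1 x : collapse x = 1 -> side x = false.
Proof.
rewrite /side => e; rewrite e oner_eq0 orbF; apply/negP => /upper_doubled.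
by rewrite e doubledE eqxx andbF andbF.
Qed.

Lemma tau_eq0_left a : 0 <= a <= c -> tau a = 0 -> a = 0.
Proof.
move=> /andP[a0 ac] ta; apply/eqP; rewrite eq_le a0 andbT leNgt; apply/negP => ap.
have := tau_incr tau_unimodal (lexx _) ap ac; rewrite ta ltNge.
by have /andP[-> _] : 0 <= tau 0 <= 1 by apply: (tau_itv tau_unimodal); rewrite lexx ler01.
Qed.

Lemma tau_eq0_right a : c <= a <= 1 -> tau a = 0 -> a = 1.
Proof.
move=> /andP[ac a1] ta; apply/eqP; rewrite eq_le a1 leNgt; apply/negP => ap.
have := tau_decr tau_unimodal ac ap (lexx _); rewrite ta ltNge.
by have /andP[-> _] : 0 <= tau 1 <= 1 by apply: (tau_itv tau_unimodal); rewrite lexx ler01.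
Qed.

Let tau_eq1 a : 0 <= a <= 1 -> tau a = 1 -> a = c.
Proof.
move=> /andP[a0 a1] ta; have /andP[c0 c1] := c01.
have e : tau a = tau c by rewrite tauc.
have [ac|ca] := leP a c.
  by apply: (tau_inj_left tau_unimodal) e; rewrite ?a0 ?ac ?lexx ?(ltW c0).
by apply: (tau_inj_right tau_unimodal) e; rewrite ?a1 ?(ltW ca) ?lexx ?(ltW c1).
Qed.

(** The last disjunct accounts for an image over 0, which always counts as 0^+. *)
Lemma side_sigma_def x : S (collapse x) -> collapse x != c ->
  side (sigma_def x) = (above c x (+) side x) || (tau (collapse x) == 0).
Proof.
move=> Sx xc; rewrite {1}/side collapse_sigma_def upper_sigma_def doubledE.
have -> : `[< S (tau (collapse x)) >] by apply/asboolP; apply: gen_orbit_tau.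
have [|] := eqVneq (tau (collapse x)) 1.
  by move=> /(tau_eq1 (collapse_itv x)) e; move: xc; rewrite e eqxx.
by move=> _; case: (tau (collapse x) == 0); rewrite ?orbT ?orbF ?andbT.
Qed.

(** The left branch carries the cut at a to the cut at tau a. For a = c both sides are false:
    nothing is above tau c = 1, and [x] is not above c. *)
Lemma above_sigma_left a x : S a -> a <= c -> ~~ above c x ->
  above (tau a) (sigma_def x) = above a x.
Proof.
move=> Sa ac nx; have xc := left_itv nx; have /andP[a0 _] := S01 Sa.
rewrite !aboveE collapse_sigma_def tau_lt_left ?a0//.
case: (ltgtP a (collapse x)) => //= [xa|e].
  by rewrite [tau a == _]gt_eqF// tau_lt_left ?a0.
rewrite -e eqxx /=; have [acc|anc] := eqVneq a c.
  move: nx; rewrite aboveE -e acc eqxx ltxx /= => /negbTE ->.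
  by rewrite side1// collapse_sigma_def -e acc.
rewrite side_sigma_def -?e// (negbTE nx) /=.
have [/tau_eq0_left t0|_] := eqVneq (tau a) 0; last by rewrite orbF.
by rewrite orbT side0// -e t0// a0.
Qed.

(** The reversal of order puts the negation here, and it is the source of the minus sign in L e_a
    for a >= c. *)
Lemma above_sigma_right a x : S a -> c <= a -> above c x ->
  above (tau a) (sigma_def x) = ~~ above a x.
Proof.
move=> Sa ac nx; have xc := right_itv nx; have /andP[_ a1] := S01 Sa.
rewrite !aboveE collapse_sigma_def tau_lt_right ?a1 ?ac//.
case: (ltgtP a (collapse x)) => //= [xa|e].
  by rewrite [tau a == _]gt_eqF// tau_lt_right ?a1 ?ac.
rewrite -e eqxx /=; have [acc|anc] := eqVneq a c.
  move: nx; rewrite aboveE -e acc eqxx ltxx /= => ->.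
  by rewrite side1// collapse_sigma_def -e acc.
rewrite side_sigma_def -?e// nx /=.
have [/tau_eq0_right t0|_] := eqVneq (tau a) 0; last by rewrite orbF.
by rewrite orbT side1// -e t0// a1 andbT.
Qed.

Lemma gen_orbit_collapse x : upper x -> S (collapse x).
Proof. by move=> /upper_doubled; rewrite doubledE => /and3P[/asboolP]. Qed.

Lemma side_upper x : upper x -> side x. Proof. by rewrite /side => ->. Qed.

Lemma side_lower x y : ~~ upper x -> upper y -> collapse x = collapse y -> side x = false.
Proof.
move=> nx uy e; rewrite /side (negbTE nx) /= e; apply/negbTE.
by have := upper_doubled uy; rewrite doubledE => /and3P[].
Qed.

(** The delicate case is a pair y^- < y^+, whose images must still be two points. They could merge
    only over 1 or 0; but on this branch tau y = 1 forces y = c, and c^+ is on the other branch,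
    while tau y = 0 forces y = 0, which is not doubled. *)
Lemma sigma_lt_left x y : ~~ above c x -> ~~ above c y -> (x < y)%O ->
  (sigma_def x < sigma_def y)%O.
Proof.
move=> nx ny; rewrite !disc_ltE !collapse_sigma_def.
rewrite tau_lt_left ?left_itv//; case/orP => [->//|/and3P[/eqP e ux uy]].
rewrite e eqxx ltxx /=; have Sy := gen_orbit_collapse uy.
rewrite !upper_sigma_def (negbTE nx) (negbTE ny) /= (side_upper uy) (side_lower ux uy)//=.
have [/tau_eq1|t1] := eqVneq (tau (collapse y)) 1.
  move=> /(_ (collapse_itv y)) yc; move: ny; rewrite aboveE side_upper// andbT.
  by rewrite yc eqxx orbT.
rewrite doubledE t1 andbT; apply/andP; split; first by apply/asboolP; apply: gen_orbit_tau.
apply/eqP => /(tau_eq0_left (left_itv ny)) y0.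
by have := upper_doubled uy; rewrite doubledE y0 eqxx andbF.
Qed.

(** A doubled pair could merge only for y = c, whose copy c^- is on the other branch, or for y = 1,
    which is not doubled. *)
Lemma sigma_lt_right x y : above c x -> above c y -> (x < y)%O ->
  (sigma_def y < sigma_def x)%O.
Proof.
move=> nx ny; rewrite !disc_ltE !collapse_sigma_def.
rewrite tau_lt_right ?right_itv//; case/orP => [->//|/and3P[/eqP e ux uy]].
rewrite e eqxx ltxx /=; have Sy := gen_orbit_collapse uy.
rewrite !upper_sigma_def nx ny /= (side_upper uy) (side_lower ux uy)//= e.
have [/tau_eq1|t1] := eqVneq (tau (collapse y)) 1.
  move=> /(_ (collapse_itv y)) yc; move: nx; rewrite aboveE (side_lower ux uy)// andbF.
  by rewrite e yc ltxx.
rewrite doubledE t1 andbT; apply/andP; split; first by apply/asboolP; apply: gen_orbit_tau.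
apply/eqP => /(tau_eq0_right (right_itv ny)) y0.
by have := upper_doubled uy; rewrite doubledE y0 eqxx !andbF.
Qed.

Let above_collapse a x : above a x -> a <= collapse x <= 1.
Proof.
rewrite aboveE => h; have /andP[_ ->] := collapse_itv x; rewrite andbT.
by rewrite le_eqVlt; case/orP: h => [->|/andP[-> _]//]; rewrite orbT.
Qed.

(** The intermediate value theorem gives a real preimage; it lies in I_1 when its image does, so the
    side of [y] can be lifted too. *)
Lemma sigma_surj_left y : above (tau 0) y -> exists2 x, ~~ above c x & sigma_def x = y.
Proof.
move=> ay; have /andP[c0 c1] := c01.
have [a /andP[a0 ac] ta] := ivt_left tau_unimodal tau_surj (above_collapse ay).
have a01 : 0 <= a <= 1 by rewrite a0 (le_trans ac (ltW c1)).
have Sa : upper y -> S a.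
  by move=> /gen_orbit_collapse; rewrite -ta; exact: gen_orbit_preim.
have na : ~~ above c (mkpt S a (upper y)).
  rewrite /above collapse_mkpt// ltNge ac /= (gt_eqF c0) orbF.
  apply/negP => /andP[/eqP e]; rewrite upper_mkpt// => /andP[/upper_doubled].
  by rewrite -ta -e tauc doubledE eqxx !andbF.
exists (mkpt S a (upper y)) => //; apply: disc_eq.
  by rewrite collapse_sigma_def collapse_mkpt.
rewrite upper_sigma_def (negbTE na) /= collapse_mkpt// ta.
rewrite /side upper_mkpt// collapse_mkpt//.
case: (boolP (upper y)) => [uy|nuy] /=.
  rewrite upper_doubled// andbT doubledE; apply/orP.
  have [|an0] := eqVneq a 0; [by right|left].
  rewrite (asboolT (Sa uy)) /=; apply/eqP => a1.
  by move: ac; rewrite a1 leNgt c1.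
have [a00|//] := eqVneq a 0; rewrite /=.
move: ay; rewrite /above -ta a00 ltxx eqxx (negbTE nuy) /= => /eqP ->.
by rewrite doubledE eqxx andbF.
Qed.

(** As on the left branch, but the preimage takes the side opposite to that of [y]. *)
Lemma sigma_surj_right y : above (tau 1) y -> exists2 x, above c x & sigma_def x = y.
Proof.
move=> ay; have /andP[c0 c1] := c01.
have [a /andP[ac a1] ta] := ivt_right tau_unimodal tau_surj (above_collapse ay).
have a0 : 0 < a := lt_le_trans c0 ac.
have a01 : 0 <= a <= 1 by rewrite a1 (ltW a0).
have Sa : upper y -> S a.
  by move=> /gen_orbit_collapse; rewrite -ta; exact: gen_orbit_preim.
have na : above c (mkpt S a (~~ upper y)).
  rewrite /above collapse_mkpt// (gt_eqF c0) orbF -implyNb -leNgt.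
  apply/implyP => ca; have e : c = a by apply/eqP; rewrite eq_le ac ca.
  rewrite upper_mkpt// -e eqxx /= doubledE (asboolT Sc) (gt_eqF c0) (lt_eqF c1) !andbT.
  by apply/negP => /upper_doubled; rewrite -ta -e tauc doubledE eqxx !andbF.
exists (mkpt S a (~~ upper y)) => //; apply: disc_eq.
  by rewrite collapse_sigma_def collapse_mkpt.
rewrite upper_sigma_def na /= collapse_mkpt// ta.
rewrite /side upper_mkpt// collapse_mkpt// (gt_eqF a0) orbF.
case: (boolP (upper y)) => [uy|nuy] /=; first exact: upper_doubled.
case: (boolP (doubled S a)) => //= da.
apply/negbTE; rewrite doubledE; apply/negP => /and3P[/asboolP Sy y0 y1].
move/negP: da; apply; rewrite doubledE (gt_eqF a0) /=; apply/andP; split.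
  by apply/asboolP; apply: gen_orbit_preim => //; rewrite ta.
apply/eqP => a11; move: ay; rewrite /above -ta a11 ltxx eqxx (negbTE nuy) /=.
by rewrite -a11 ta (negbTE y0).
Qed.

Let above_tau0 x : ~~ above c x -> above (tau 0) (sigma_def x).
Proof. by move=> h; rewrite above_sigma_left ?above0//; case/andP: c01 => /ltW. Qed.

Let above_tau1 x : above c x -> above (tau 1) (sigma_def x).
Proof. by move=> h; rewrite above_sigma_right ?(above1 S01)//; case/andP: c01 => _ /ltW. Qed.

Lemma sigma_inj_left x y : ~~ above c x -> ~~ above c y ->
  sigma_def x = sigma_def y -> x = y.
Proof.
move=> nx ny e; case: (ltgtP x y) => // [/(sigma_lt_left nx ny)|/(sigma_lt_left ny nx)];
  by rewrite e ltxx.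
Qed.

Lemma sigma_inj_right x y : above c x -> above c y ->
  sigma_def x = sigma_def y -> x = y.
Proof.
move=> nx ny e; case: (ltgtP x y) => // [/(sigma_lt_right nx ny)|/(sigma_lt_right ny nx)];
  by rewrite e ltxx.
Qed.

Lemma open_above a : S a -> open [set x : X | above a x].
Proof.
move=> Sa; rewrite openE => x /= ax; apply: filterS (above_near S01 x Sa) => y.
by rewrite ax.
Qed.

Lemma open_not_above a : S a -> open [set x : X | ~~ above a x].
Proof.
move=> Sa; rewrite openE => x /= ax; apply: filterS (above_near S01 x Sa) => y /=.
by rewrite (negbTE ax) => ->.
Qed.

(** Each branch is clopen and is mapped monotonically onto a final segment of X, so preimages of
    open rays are open. *)
Lemma sigma_def_continuous : continuous (sigma_def : X -> X).
Proof.
have lt_mono_left x y : ~~ above c x -> ~~ above c y ->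
    (sigma_def x < sigma_def y)%O = (x < y)%O.
  move=> nx ny; apply/idP/idP; last exact: sigma_lt_left.
  case: (ltgtP x y) => // [/(sigma_lt_left ny nx) h /(lt_trans h)|->]; by rewrite ltxx.
have lt_mono_right x y : above c x -> above c y ->
    (sigma_def x < sigma_def y)%O = (y < x)%O.
  move=> nx ny; apply/idP/idP; last exact: sigma_lt_right.
  case: (ltgtP x y) => // [/(sigma_lt_right nx ny) h /(lt_trans h)|->]; by rewrite ltxx.
have lt_above a (x y : X) : above a x -> ~~ above a y -> (y < x)%O.
  move=> ax nay; rewrite ltNge; apply/negP => xy; move/negP: nay; apply.
  move: ax xy; rewrite /above disc_leE.
  case: (ltgtP a (collapse x)) => //= [ax _|->].
    by case: ltgtP => //= [xy|<-]; rewrite ?ax// (lt_trans ax xy).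
  case/orP => [ux|->]; last by rewrite orbT andbT; case: ltgtP.
  by rewrite ux /=; case: ltgtP => //= _ ->.
have near_gt (z p : X) : (p < z)%O -> \forall y \near z, (p < y)%O.
  move=> pz; apply: filterS (open_nbhs_nbhs (conj (@rray_open _ X p) _)).
    by move=> y /=; rewrite in_itv /= andbT.
  by rewrite /= in_itv /= andbT.
have near_lt (z p : X) : (z < p)%O -> \forall y \near z, (y < p)%O.
  move=> pz; apply: filterS (open_nbhs_nbhs (conj (@lray_open _ X p) _)).
    by move=> y /=; rewrite in_itv.
  by rewrite /= in_itv.
(* On each branch [p] is either a value sigma w, and the inequality becomes a comparison with w, or
   it lies below the whole image of the branch. *)
have preL p (z : X) : (sigma_def z < p)%O -> \forall y \near z, (sigma_def y < p)%O.
  move=> zp; have [az|az] := boolP (above c z).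
  - have nz : \forall y \near z, above c y.
      exact: (open_nbhs_nbhs (conj (open_above Sc) az)).
    have [/sigma_surj_right [w aw e]|ap] := boolP (above (tau 1) p).
      move: zp; rewrite -e lt_mono_right// => /near_gt.
      by apply: filterS2 nz => y ay; rewrite lt_mono_right.
    by have := lt_trans zp (lt_above _ _ _ (above_tau1 az) ap); rewrite ltxx.
  - have nz : \forall y \near z, ~~ above c y.
      exact: (open_nbhs_nbhs (conj (open_not_above Sc) az)).
    have [/sigma_surj_left [w aw e]|ap] := boolP (above (tau 0) p).
      move: zp; rewrite -e lt_mono_left// => /near_lt.
      by apply: filterS2 nz => y ay; rewrite lt_mono_left.
    by have := lt_trans zp (lt_above _ _ _ (above_tau0 az) ap); rewrite ltxx.
have preG p (z : X) : (p < sigma_def z)%O -> \forall y \near z, (p < sigma_def y)%O.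
  move=> zp; have [az|az] := boolP (above c z).
  - have nz : \forall y \near z, above c y.
      exact: (open_nbhs_nbhs (conj (open_above Sc) az)).
    have [/sigma_surj_right [w aw e]|ap] := boolP (above (tau 1) p).
      move: zp; rewrite -e lt_mono_right// => /near_lt.
      by apply: filterS2 nz => y ay; rewrite lt_mono_right.
    by apply: filterS nz => y /above_tau1 ay; apply: lt_above ap.
  - have nz : \forall y \near z, ~~ above c y.
      exact: (open_nbhs_nbhs (conj (open_not_above Sc) az)).
    have [/sigma_surj_left [w aw e]|ap] := boolP (above (tau 0) p).
      move: zp; rewrite -e lt_mono_left// => /near_gt.
      by apply: filterS2 nz => y ay; rewrite lt_mono_left.
    by apply: filterS nz => y /above_tau0 ay; apply: lt_above ap.
move=> z U; rewrite itv_nbhsE => -[i [oi zi] iU].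
suff : \forall y \near z, sigma_def y \in i.
  by apply: filterS => y yi; apply: iU.
case: i oi zi {iU} => -[[] u|[]] [[] v|[]]//= _; rewrite in_itv /= ?andbT.
- move=> /andP[/preG + /preL]; apply: filterS2 => y.
  by rewrite in_itv /= => -> ->.
- by move=> /preG; apply: filterS => y; rewrite in_itv /= andbT.
- by move=> /preL; apply: filterS => y; rewrite in_itv.
- by move=> _; apply: filterE => y; rewrite in_itv.
Qed.

(** If x is outside I_1, so is tau x, because I_1 is closed under preimages. Exactly one point of X
    lies over tau x, so the specification determines sigma on a dense set. *)
Lemma sigmaE : sigma tau c = sigma_def.
Proof.
have cS := gen_orbit_countable tau_unimodal.
have spec : assoc_local_homeo_spec tau sigma_def.
  by split=> [|x _]; [exact: sigma_def_continuous|exact: collapse_sigma_def].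
rewrite /sigma /assoc_local_homeo; case: xgetP => [f _ [fC ft]|]; last by move=> /(_ _ spec).
apply: (eq_continuous_undoubled S01 cS fC sigma_def_continuous) => x Sx.
have e : collapse (f x) = tau (collapse x) by exact: ft.
have nS : ~ S (tau (collapse x)) 
  by move=> h; apply: Sx; apply: gen_orbit_preim h; exact: collapse_itv.
apply: disc_eq; first by rewrite collapse_sigma_def.
rewrite upper_sigma_def; have -> : doubled S (tau (collapse x)) = false.
  by rewrite doubledE asboolF.
rewrite andbF; apply/negP => /upper_doubled; rewrite e doubledE.
by case/and3P => /asboolP.
Qed.

End SigmaMap.

(** * The transfer map *)

Section Transfer.
Local Open Scope classical_set_scope.
Context {R : realType}.
Variables (tau : R -> R) (c : R).
Hypothesis tau_unimodal : unimodal tau c.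
Hypothesis tau_surj : surjective_on_I tau.
Notation S := (I1 tau c).
Notation X := (disc_X tau c).
Notation sg := (sigma tau c).
Implicit Types (a b : R) (x y z : X) (f g : X -> int).

Let c01 : 0 < c < 1. Proof. by case: tau_unimodal. Qed.
Let S01 := gen_orbit_itv tau_unimodal.
Let S0 : S 0 := @gen_orbit0 _ tau c.
Let Sc : S c := @gen_orbitc _ tau c.
Let S1 : S 1 := @gen_orbit1 _ tau c.
Let sgE := sigmaE tau_unimodal tau_surj.

(** Both branches are injective, so a fibre of sigma has at most one point on each; [left_sum] and
    [right_sum] isolate their contributions to [transfer]. *)
Definition left_sum f y : int :=
  if pselect (exists2 x, ~~ above c x & sg x = y) is left e then f (sval (cid2 e)) else 0.
Definition right_sum f y : int :=
  if pselect (exists2 x, above c x & sg x = y) is left e then f (sval (cid2 e)) else 0.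

Lemma left_sumE f x : ~~ above c x -> left_sum f (sg x) = f x.
Proof.
move=> ax; rewrite /left_sum; case: pselect => [e|[]]; last by exists x.
case: cid2 => z /= az; rewrite sgE => /(sigma_inj_left tau_unimodal tau_surj az ax) -> //.
Qed.

Lemma right_sumE f x : above c x -> right_sum f (sg x) = f x.
Proof.
move=> ax; rewrite /right_sum; case: pselect => [e|[]]; last by exists x.
case: cid2 => z /= az; rewrite sgE => /(sigma_inj_right tau_unimodal tau_surj az ax) -> //.
Qed.

Lemma transferE f y : transfer sg f y = left_sum f y + right_sum f y.
Proof.
rewrite /transfer /left_sum /right_sum.
have injL := sigma_inj_left tau_unimodal tau_surj.
have injR := sigma_inj_right tau_unimodal tau_surj.
case: pselect => [e|ne]; [case: (cid2 e) => u /= au su|];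
  (case: pselect => [e'|ne']; [case: (cid2 e') => v /= av sv|]).
- have -> : sg @^-1` [set y] = [set u; v].
    apply/seteqP; split=> z /=; last by case=> ->.
    rewrite sgE => zy; have [az|az] := boolP (above c z); [right|left].
      by apply: injR; rewrite // zy -sv sgE.
    by apply: injL; rewrite // zy -su sgE.
  have uv : u != v by apply/eqP => uv; move: au; rewrite uv av.
  rewrite fset_setU1// fset_set1 big_fsetU1 ?big_seq_fset1//=.
  by rewrite inE.
- have -> : sg @^-1` [set y] = [set u].
    apply/seteqP; split=> z /=; last by move=> ->.
    move=> zy; have [az|az] := boolP (above c z); first by case: ne'; exists z.
    by apply: injL; rewrite // -sgE zy su.
  by rewrite fset_set1 big_seq_fset1 addr0.
- have -> : sg @^-1` [set y] = [set v].
    apply/seteqP; split=> z /=; last by move=> ->.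
    move=> zy; have [az|az] := boolP (above c z); last by case: ne; exists z.
    by apply: injR; rewrite // -sgE zy sv.
  by rewrite fset_set1 big_seq_fset1 add0r.
- have -> : sg @^-1` [set y] = set0.
    apply/seteqP; split=> z //= zy; have [az|az] := boolP (above c z).
      by case: ne'; exists z.
    by case: ne; exists z.
  by rewrite fset_set0 big_seq_fset0 addr0.
Qed.

Notation e_ := (@cut_fun R S).

Lemma above_le a b x : a <= b -> above b x -> above a x.
Proof.
move=> ab; rewrite !aboveE; case: (ltgtP a b) ab => //= [ab _|->//].
by case/orP => [h|/andP[/eqP <- _]]; rewrite ?ab// (lt_trans ab h).
Qed.

Lemma left_sum0 f y : ~~ above (tau 0) y -> left_sum f y = 0.
Proof.
move=> ay; rewrite /left_sum; case: pselect => // -[x ax xy]; move/negP: ay; case.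
have /andP[/ltW c0 _] := c01.
by rewrite -xy sgE (above_sigma_left tau_unimodal tau_surj S0)// above0.
Qed.

Lemma right_sum0 f y : ~~ above (tau 1) y -> right_sum f y = 0.
Proof.
move=> ay; rewrite /right_sum; case: pselect => // -[x ax xy]; move/negP: ay; case.
have /andP[_ /ltW c1] := c01.
by rewrite -xy sgE (above_sigma_right tau_unimodal tau_surj S1)// (above1 S01).
Qed.

Let tau_le_left a : 0 <= a <= c -> tau 0 <= tau a.
Proof.
move=> /andP[a0 ac]; have [->//|an0] := eqVneq a 0.
by rewrite ltW// (tau_incr tau_unimodal)// lt_neqAle eq_sym an0.
Qed.

Let tau_le_right a : c <= a <= 1 -> tau 1 <= tau a.
Proof.
move=> /andP[a0 ac]; have [->//|an0] := eqVneq a 1.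
by rewrite ltW// (tau_decr tau_unimodal)// lt_neqAle an0.
Qed.

(** The left branch maps [a^+, c^-] onto the final segment that starts at (tau a)^+, since tau c =
    1. *)
Lemma left_sum_cut a y : S a -> a <= c -> left_sum (e_ a) y = e_ (tau a) y.
Proof.
move=> Sa ac; have /andP[a0 _] := S01 Sa; have [ay|nay] := boolP (above (tau 0) y).
  have [x nx <-] := sigma_surj_left tau_unimodal tau_surj ay.
  rewrite -sgE left_sumE// /cut_fun sgE.
  by rewrite (above_sigma_left tau_unimodal tau_surj).
rewrite left_sum0// /cut_fun; case: (boolP (above (tau a) y)) => // h.
by move/negP: nay; case; apply: above_le h; rewrite tau_le_left// a0.
Qed.

Lemma left_sum_cut0 a y : c <= a -> left_sum (e_ a) y = 0.
Proof.
move=> ca; rewrite /left_sum; case: pselect => // e; case: cid2 => x /= nx _.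
rewrite /cut_fun; case: (boolP (above a x)) => // /(above_le ca) h.
by move: nx; rewrite h.
Qed.

(** The cut is 1 on the whole right branch, so the sum is the indicator of the image of that
    branch. *)
Lemma right_sum_cut1 a y : a <= c -> right_sum (e_ a) y = e_ (tau 1) y.
Proof.
have /andP[_ /ltW c1] := c01.
move=> ca; rewrite /right_sum; case: pselect => [e|ne].
  case: cid2 => x /= nx <-; rewrite /cut_fun (above_le ca)// sgE.
  by rewrite (above_sigma_right tau_unimodal tau_surj S1)// (above1 S01).
rewrite /cut_fun; case: (boolP (above (tau 1) y)) => // h; case: ne.
by have [x ax xy] := sigma_surj_right tau_unimodal tau_surj h; exists x; rewrite ?sgE.
Qed.

(** The part of the right branch above a is mapped onto the points above tau 1 that are not above
    tau a. *)
Lemma right_sum_cut a y : S a -> c <= a ->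
  right_sum (e_ a) y = e_ (tau 1) y - e_ (tau a) y.
Proof.
move=> Sa ca; have /andP[_ a1] := S01 Sa; have [ay|nay] := boolP (above (tau 1) y).
  have [x nx <-] := sigma_surj_right tau_unimodal tau_surj ay.
  have /andP[_ /ltW c1] := c01.
  rewrite -sgE right_sumE// /cut_fun sgE.
  rewrite !(above_sigma_right tau_unimodal tau_surj)// (above1 S01) /=.
  by case: (above a x).
rewrite right_sum0// /cut_fun (negbTE nay); case: (boolP (above (tau a) y)) => // h.
by move/negP: nay; case; apply: above_le h; rewrite tau_le_right// a1 ca.
Qed.

Definition cut a : cont_int X := to_cont_int (e_ a).

Lemma to_cont_intK f : f \in @cont_int_pred X -> to_cont_int f = f :> (X -> int).
Proof. by move=> fC; rewrite /to_cont_int; apply: (insubdK _ fC). Qed.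

Lemma cutE a : S a -> cut a = e_ a :> (X -> int).
Proof. by move=> Sa; apply: to_cont_intK; apply: cut_fun_cont. Qed.

Lemma cont_int_eq (f g : cont_int X) : f =1 g -> f = g.
Proof. by move=> fg; apply: val_inj; apply/funext. Qed.

Lemma cont_intD (f g : cont_int X) x : (f + g) x = f x + g x.
Proof. by []. Qed.
Lemma cont_intB (f g : cont_int X) x : (f - g) x = f x - g x.
Proof. by []. Qed.

Lemma cont_int_sum I (r : seq I) (F : I -> cont_int X) x :
  (\sum_(i <- r) F i) x = \sum_(i <- r) F i x.
Proof.
by elim: r => [|i r ih]; rewrite ?big_nil// !big_cons -ih.
Qed.

Lemma cont_intMz (f : cont_int X) m x : (f *~ m) x = f x * m.
Proof.
have nat n : (f *+ n) x = f x *+ n by elim: n => // n ih; rewrite !mulrS -ih.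
case: m => n; first by rewrite -pmulrn nat -mulr_natr natz.
rewrite NegzE mulrNz -pmulrn.
by rewrite -[LHS]/(- (f *+ n.+1) x) nat -mulr_natr natz mulrN.
Qed.

Lemma cont_int_cut (f : cont_int X) : exists2 s : seq (R * int),
  {in s, forall p, S p.1} & f = \sum_(p <- s) cut p.1 *~ p.2.
Proof.
have [s hs fs] := cut_sum_rep S01 S0 (valP f); exists s => //.
apply: cont_int_eq => x; rewrite [LHS](congr1 (@^~ x) fs) cont_int_sum.
by apply: eq_big_seq => p /hs Sp; rewrite cont_intMz cutE// mulrC.
Qed.

Lemma transfer_cut_left a : S a -> a <= c ->
  transfer sg (cut a) =1 cut (tau a) + cut (tau 1).
Proof.
move=> Sa ac y; rewrite transferE (cutE Sa) left_sum_cut// right_sum_cut1//.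
by rewrite cont_intD !cutE//; exact: gen_orbit_tau.
Qed.

Lemma transfer_cut_right a : S a -> c <= a ->
  transfer sg (cut a) =1 cut (tau 1) - cut (tau a).
Proof.
move=> Sa ac y; rewrite transferE (cutE Sa) left_sum_cut0// right_sum_cut// add0r.
by rewrite cont_intB !cutE//; exact: gen_orbit_tau.
Qed.

(** It suffices to consider cuts, which span, and the transfer of a cut is a combination of cuts. *)
Lemma transfer_cont (f : cont_int X) : exists g : cont_int X, transfer sg f = g.
Proof.
have [s + ->] := cont_int_cut f; elim: s => [|p s ih] hs.
  by exists 0; rewrite big_nil; apply/funext => x; rewrite /transfer big1.
have [g gE] : exists g : cont_int X, transfer sg (cut p.1) = g.
  have Sp := hs p (mem_head _ _); have [pc|/ltW pc] := leP p.1 c.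
    by exists (cut (tau p.1) + cut (tau 1)); apply/funext; apply: transfer_cut_left.
  by exists (cut (tau 1) - cut (tau p.1)); apply/funext; apply: transfer_cut_right.
have [h hE] : exists h : cont_int X, transfer sg (\sum_(j <- s) cut j.1 *~ j.2) = h.
  by apply: ih => q qs; apply: hs; rewrite in_cons qs orbT.
exists (g *~ p.2 + h); rewrite big_cons; apply/funext => x.
rewrite cont_intD cont_intMz -gE -hE /transfer mulr_suml -big_split /=.
by apply: eq_bigr => y _; rewrite -cont_intMz.
Qed.

Definition ctransfer (f : cont_int X) : cont_int X := to_cont_int (transfer sg f).

Lemma ctransferE (f : cont_int X) : ctransfer f = transfer sg f :> (X -> int).
Proof.
by have [g gE] := transfer_cont f; apply: to_cont_intK; rewrite gE; exact: valP.
Qed.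

Lemma ctransferB (f g : cont_int X) : ctransfer (f - g) = ctransfer f - ctransfer g.
Proof.
apply: cont_int_eq => x; rewrite cont_intB !ctransferE.
by rewrite -[LHS]/(transfer sg (val f - val g) x) transferB.
Qed.

Lemma ctransfer_cut_left a : S a -> a <= c ->
  ctransfer (cut a) = cut (tau a) + cut (tau 1).
Proof. by move=> Sa ac; apply: cont_int_eq => x; rewrite ctransferE transfer_cut_left. Qed.

Lemma ctransfer_cut_right a : S a -> c <= a ->
  ctransfer (cut a) = cut (tau 1) - cut (tau a).
Proof. by move=> Sa ac; apply: cont_int_eq => x; rewrite ctransferE transfer_cut_right. Qed.

Lemma cut1 : cut 1 = 0.
Proof. by apply: cont_int_eq => x; rewrite cutE// /cut_fun (above1 S01). Qed.

Lemma iter_ctransferE n (f : cont_int X) :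
  iter n ctransfer f = iter n (transfer sg) f :> (X -> int).
Proof. by elim: n => //= n <-; rewrite ctransferE. Qed.

Lemma sigma_continuous : continuous sg.
Proof. by rewrite sgE; exact: sigma_def_continuous. Qed.

(* One of the two branches of sigma is onto: transport g along its inverse. *)
Lemma ctransfer_section (g : cont_int X) : exists2 f : cont_int X,
  ctransfer f = g & (forall x, 0 <= g x) -> forall x, 0 <= f x.
Proof.
have ind (A : pred X) : (forall x, \forall y \near x, A y = A x) ->
    (fun x : X => if A x then g (sg x) else 0) \in @cont_int_pred X.
  move=> hA; apply/cont_intP => x.
  have gN := cont_intP _ (valP g).
  have gx : \forall y \near x, g (sg y) = g (sg x) := sigma_continuous (gN (sg x)).
  by apply: filterS2 (hA x) gx => y -> ->.
have nonneg (A : pred X) : (forall x, 0 <= g x) -> forall x, 0 <= if A x then g (sg x) else 0.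
  by move=> g0 x; case: ifP.
case: (tau_ends tau_unimodal tau_surj) => t0.
- have iC := @ind (fun x => ~~ above c x) _.
  exists (to_cont_int (fun x : X => if ~~ above c x then g (sg x) else 0)); last first.
    move=> g0 x; rewrite to_cont_intK; first exact: (nonneg (fun z => ~~ above c z)).
    by apply: iC => z; apply: filterS (above_near S01 z Sc) => y ->.
  apply: cont_int_eq => y; rewrite ctransferE to_cont_intK; last first.
    by apply: iC => z; apply: filterS (above_near S01 z Sc) => w ->.
  have [|x nx <-] := @sigma_surj_left _ _ _ tau_unimodal tau_surj y; first by rewrite t0 above0.
  rewrite transferE -sgE left_sumE// nx /right_sum; case: pselect => [e|_]; last by rewrite addr0.
  by case: cid2 => z /= -> _; rewrite addr0.
- have iC := @ind (fun x => above c x) _.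
  exists (to_cont_int (fun x : X => if above c x then g (sg x) else 0)); last first.
    move=> g0 x; rewrite to_cont_intK; first exact: (nonneg (fun z => above c z)).
    by apply: iC => z; apply: (above_near S01 z Sc).
  apply: cont_int_eq => y; rewrite ctransferE to_cont_intK; last first.
    by apply: iC => z; apply: (above_near S01 z Sc).
  have [|x nx <-] := @sigma_surj_right _ _ _ tau_unimodal tau_surj y; first by rewrite t0 above0.
  rewrite transferE -sgE right_sumE// nx /left_sum; case: pselect => [e|_]; last by rewrite add0r.
  by case: cid2 => z /= /negbTE -> _; rewrite add0r.
Qed.
End Transfer.

(** * Modules over the Laurent polynomials *)

Section LaurentAction.
Variables (V : zmodType) (T : {additive V -> V}).
Implicit Types (p q : {poly int}) (a b : laurent) (v : V).
Local Notation "p %:F" := (@tofrac {poly int} p).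

Definition poly_act p v : V := \sum_(i < size p) iter i T v *~ p`_i.

Lemma poly_actE n p v : (size p <= n)%N -> poly_act p v = \sum_(i < n) iter i T v *~ p`_i.
Proof.
move=> pn; rewrite /poly_act (big_ord_widen _ (fun i => iter i T v *~ p`_i) pn) big_mkcond.
apply: eq_bigr => i _; case: ltnP => // h.
by rewrite nth_default ?mulr0z.
Qed.

Lemma poly_actB p q v : poly_act (p - q) v = poly_act p v - poly_act q v.
Proof.
rewrite !(@poly_actE (maxn (size p) (size q))) ?leq_maxl ?leq_maxr//.
  by rewrite -sumrB; apply: eq_bigr => i _; rewrite coefB mulrzBr.
by rewrite -[X in maxn _ X](size_polyN q); exact: size_polyD.
Qed.

Lemma poly_actMX p v : poly_act (p * 'X) v = T (poly_act p v).
Proof.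
rewrite (@poly_actE (size p).+1); last first.
  by apply: leq_trans (size_polyMleq _ _) _; rewrite size_polyX addn2.
rewrite big_ord_recl coefMX eqxx mulr0z add0r /poly_act raddf_sum.
by apply: eq_bigr => i _; rewrite coefMX /= raddfMz.
Qed.

Lemma poly_actMXn p n v : poly_act (p * 'X^n) v = iter n T (poly_act p v).
Proof. by elim: n => [|n ih]; rewrite ?mulr1// exprSr mulrA poly_actMX ih. Qed.

Lemma poly_act1 v : poly_act 1 v = v.
Proof. by rewrite /poly_act size_poly1 big_ord_recl big_ord0 addr0 coef1. Qed.

Lemma iter_additive0 n : iter n T 0 = 0.
Proof. by elim: n => //= n ->; rewrite raddf0. Qed.

Lemma iter_additiveB n v w : iter n T (v - w) = iter n T v - iter n T w.
Proof. by elim: n => //= n ->; rewrite raddfB. Qed.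

Hypotheses (T_inj : injective T) (T_surj : forall v, exists w, T w = v).

Lemma iter_additive_inj n : injective (iter n T).
Proof. by elim: n => // n ih x y /= /T_inj /ih. Qed.

Lemma aut_invK : cancel (aut_inv T) T.
Proof.
move=> v; rewrite /aut_inv; case: xgetP => [w _ //|h].
by have [w wv] := T_surj v; case: (h w).
Qed.

Lemma iter_aut_invK n : cancel (iter n (aut_inv T)) (iter n T).
Proof. by elim: n => // n ih v; rewrite iterSr [iter n.+1 _ _]iterS aut_invK. Qed.

Lemma Xn_frac_neq0 n : ('X^n)%:F != 0.
Proof. by rewrite tofrac_eq0 monic_neq0 ?monicXn. Qed.

(** Any fraction for [a] may be used, not just the one chosen by [laurent_frac]: a power of T clears
    the chosen denominator, both sides become actions of the same polynomial, and T is injective. *)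
Lemma laurent_actP a n p v : laurent_val a * ('X^n)%:F = p%:F ->
  iter n T (laurent_act T a v) = poly_act p v.
Proof.
move=> ap; rewrite /laurent_act /laurent_frac; case: cid => -[m q] /= aq.
apply: (@iter_additive_inj m); rewrite -iterD addnC iterD iter_aut_invK.
rewrite -/(poly_act q v) -!poly_actMXn; congr (poly_act _ v).
apply/eqP; rewrite -tofrac_eq !tofracM -ap -aq.
by rewrite mulrAC.
Qed.

Lemma laurent_fracP a : exists n p, laurent_val a * ('X^n)%:F = p%:F.
Proof. by have /asboolP[[n p] h] := laurent_valP a; exists n, p. Qed.

Lemma laurent_actB a b v :
  laurent_act T (a - b) v = laurent_act T a v - laurent_act T b v.
Proof.
have [n [p ap]] := laurent_fracP a; have [m [q bq]] := laurent_fracP b.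
apply: (@iter_additive_inj (n + m)); rewrite iter_additiveB.
rewrite [in iter _ _ (laurent_act T a v)]addnC !iterD (laurent_actP v ap) (laurent_actP v bq).
rewrite -!poly_actMXn -poly_actB -iterD; apply: laurent_actP => /=.
rewrite exprD tofracM mulrBl mulrA ap mulrCA bq tofracB !tofracM.
by rewrite [('X^n)%:F * _]mulrC.
Qed.

Lemma laurent_act_t a v : laurent_act T (laurent_t * a) v = T (laurent_act T a v).
Proof.
have [n [p ap]] := laurent_fracP a.
apply: (@iter_additive_inj n); rewrite -iterSr iterS (laurent_actP v ap) -poly_actMX.
by apply: laurent_actP => /=; rewrite -mulrA ap tofracM mulrC.
Qed.

Lemma laurent_act1 v : laurent_act T 1 v = v.
Proof. by rewrite -[RHS]poly_act1; apply: (@laurent_actP 1 0%N) => /=; rewrite expr0 mul1r. Qed.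

(** The submodule generated by [v] is closed under T^-1: divide [a] by t. *)
Lemma laurent_act_tV a v w : T w = laurent_act T a v ->
  exists b, w = laurent_act T b v.
Proof.
move=> wa; have [n [p ap]] := laurent_fracP a.
have bP : laurent_val a / 'X%:F \in laurent_pred.
  apply/asboolP; exists (n.+1, p) => /=.
  by rewrite exprS tofracM mulrA divfK ?ap// (Xn_frac_neq0 1).
exists (Laurent bP); apply: T_inj; rewrite wa -laurent_act_t; congr (laurent_act T _ v).
by apply: val_inj => /=; rewrite mulrC divfK// (Xn_frac_neq0 1).
Qed.

(** As t is invertible, an annihilator can be multiplied by a power of t and looked for among
    polynomials. *)
Lemma laurent_act_eq0 a v : (forall p, poly_act p v = 0 -> p = 0) ->
  laurent_act T a v = 0 -> a = 0.
Proof.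
move=> h a0; have [n [p ap]] := laurent_fracP a.
have p0 : p = 0 by apply: h; rewrite -(laurent_actP v ap) a0 iter_additive0.
apply: val_inj => /=; move: ap; rewrite p0 tofrac0 => /eqP.
by rewrite mulf_eq0 (negbTE (Xn_frac_neq0 n)) orbF => /eqP.
Qed.

End LaurentAction.

(** * The dimension module *)

Section DimensionModule.
Local Open Scope classical_set_scope.
Context {R : realType}.
Variables (tau : R -> R) (c : R).
Hypothesis tau_unimodal : unimodal tau c.
Hypothesis tau_surj : surjective_on_I tau.
Notation S := (I1 tau c).
Notation X := (disc_X tau c).
Notation sg := (sigma tau c).
Notation L := (@ctransfer R tau c).
Implicit Types (a b : R) (x y z : X) (f g : cont_int X).

Let c01 : 0 < c < 1. Proof. by case: tau_unimodal. Qed.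
Let S01 := gen_orbit_itv tau_unimodal.
Let S0 : S 0 := @gen_orbit0 _ tau c.
Let Sc : S c := @gen_orbitc _ tau c.
Let S1 : S 1 := @gen_orbit1 _ tau c.

HB.instance Definition _ :=
  GRing.isZmodMorphism.Build (cont_int X) (cont_int X) L (ctransferB tau_unimodal tau_surj).

Definition dcls f : DG tau c := dim_class sg f.

Lemma dclsB f g : dcls (f - g) = dcls f - dcls g.
Proof.
have e : - dcls g = dcls (- g) := @dim_class_opp _ sg g.
by rewrite e; apply/esym; exact: (@dim_class_add _ sg f (- g)).
Qed.

HB.instance Definition _ :=
  GRing.isZmodMorphism.Build (cont_int X) (DG tau c) dcls dclsB.

Lemma dclsP f g : dcls f = dcls g <-> exists n, iter n L f = iter n L g.
Proof.
split=> [/eqP/dim_classP[n fg]|[n fg]].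
  by exists n; apply: cont_int_eq => x; rewrite !iter_ctransferE// fg.
by apply/eqP/dim_classP; exists n; rewrite -!iter_ctransferE// fg.
Qed.

Lemma dcls_repr (u : DG tau c) : exists f, u = dcls f.
Proof. by exists (repr u); rewrite /dcls dim_reprK. Qed.

Lemma DG_aut_dcls f : DG_aut tau c (dcls f) = dcls (L f).
Proof.
have -> : DG_aut tau c (dcls f) = dcls (L (repr (dcls f))) by [].
have /dclsP[n nf] : dcls (repr (dcls f)) = dcls f by exact: dim_reprK.
by apply/dclsP; exists n; rewrite -!iterSr !iterS nf.
Qed.

Lemma DG_autB (u v : DG tau c) : DG_aut tau c (u - v) = DG_aut tau c u - DG_aut tau c v.
Proof.
have [f ->] := dcls_repr u; have [g ->] := dcls_repr v.
by rewrite -raddfB !DG_aut_dcls !raddfB.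
Qed.

HB.instance Definition _ :=
  GRing.isZmodMorphism.Build (DG tau c) (DG tau c) (DG_aut tau c) DG_autB.
Notation T := (DG_aut tau c).

(** Classes are equal when some iterates of L agree, so one more application of L cannot identify
    new classes. *)
Lemma DG_aut_inj : injective T.
Proof.
move=> u v; have [f ->] := dcls_repr u; have [g ->] := dcls_repr v.
rewrite !DG_aut_dcls => /dclsP[n fg]; apply/dclsP; exists n.+1.
by rewrite !iterSr.
Qed.

Lemma DG_aut_surj v : exists u, T u = v.
Proof.
have [g ->] := dcls_repr v; have [f fg _] := ctransfer_section tau_unimodal tau_surj g.
by exists (dcls f); rewrite DG_aut_dcls fg.
Qed.

Lemma upper_ptE a : 0 <= a <= 1 -> upper_pt S a = mkpt S a true.
Proof.
move=> a01; rewrite /upper_pt; case: xgetP => [x _ /= [xa xm]|/(_ (mkpt S a true))[]]; last first.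
  split=> [|y ya]; first exact: collapse_mkpt.
  rewrite disc_leE collapse_mkpt// upper_mkpt// ya eqxx ltxx /=.
  by apply/implyP => /upper_doubled; rewrite ya.
apply/eqP; rewrite eq_le xm ?collapse_mkpt// andbT.
rewrite disc_leE collapse_mkpt// upper_mkpt// xa eqxx ltxx /=.
by apply/implyP => /upper_doubled; rewrite xa.
Qed.

Lemma lower_ptE a : 0 <= a <= 1 -> lower_pt S a = mkpt S a false.
Proof.
move=> a01; rewrite /lower_pt; case: xgetP => [x _ /= [xa xm]|/(_ (mkpt S a false))[]]; last first.
  split=> [|y ya]; first exact: collapse_mkpt.
  by rewrite disc_leE collapse_mkpt// upper_mkpt// ya eqxx ltxx.
apply/eqP; rewrite eq_le xm ?collapse_mkpt//=.
by rewrite disc_leE collapse_mkpt// upper_mkpt// xa eqxx ltxx.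
Qed.

Lemma mem_dinterval a b x : S a -> S b -> a < b ->
  dinterval S a b x <-> above a x && ~~ above b x.
Proof.
move=> Sa Sb ab; have a01 := S01 Sa; have b01 := S01 Sb.
have a1 : a < 1 by apply: lt_le_trans ab _; case/andP: b01.
have b0 : 0 < b by apply: le_lt_trans ab; case/andP: a01.
rewrite /dinterval /= in_itv /= upper_ptE// lower_ptE//.
rewrite !disc_leE !collapse_mkpt// !upper_mkpt//= doubledE (asboolT Sa) (lt_eqF a1) /=.
rewrite /above (gt_eqF b0) orbF andbT implybF implybE negbK orbC.
have -> : (collapse x < b) || (collapse x == b) && ~~ upper x =
   ~~ ((b < collapse x) || (b == collapse x) && upper x).
  by case: ltgtP.
by rewrite [(a == 0) || _]orbC [X in X && _]orbC.
Qed.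

Lemma DG_interval_cut a b : S a -> S b -> a < b ->
  DG_interval tau c a b = dcls (cut tau c a - cut tau c b).
Proof.
move=> Sa Sb ab; rewrite /DG_interval /dim_indic -/(dcls _); congr dcls.
have e : (fun x : X => (x \in dinterval S a b)%:R) = cut tau c a - cut tau c b :> (X -> int).
  apply/funext => x; rewrite cont_intB !cutE// /cut_fun.
  have -> : (x \in dinterval S a b) = above a x && ~~ above b x.
    by apply/idP/idP; [rewrite inE|move=> h; rewrite inE]; rewrite mem_dinterval.
  by have := @above_le _ _ _ a b x (ltW ab); case: (above b x) => [->|_]//; case: (above a x).
apply: cont_int_eq => x; rewrite to_cont_intK; last by rewrite e; exact: valP.
exact: (congr1 (@^~ x) e).
Qed.

Notation e := (dcls (cut tau c 0)).

Lemma DG_interval01 : DG_interval tau c 0 1 = e.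
Proof. by rewrite DG_interval_cut// ?cut1// subr0. Qed.

(** Treats both branches at once: the sign is invertible, so L e_a and e_{tau a} determine each
    other modulo e_{tau 1}. *)
Lemma ctransfer_cut_sign a : S a -> exists2 s : int, s = 1 \/ s = -1 &
  L (cut tau c a) = cut tau c (tau a) *~ s + cut tau c (tau 1).
Proof.
move=> Sa; have [ac|/ltW ca] := leP a c.
  by exists 1; [left|rewrite ctransfer_cut_left].
by exists (-1); [right|rewrite ctransfer_cut_right// mulrNz addrC].
Qed.

Theorem DG_cyclic : cyclic_with_generator T e.
Proof.
pose M v := exists l : laurent, v = laurent_act T l e.
have MB u v : M u -> M v -> M (u - v).
  move=> [a ->] [b ->]; exists (a - b).
  by rewrite (laurent_actB DG_aut_inj DG_aut_surj).
have Me : M e by exists 1; rewrite (laurent_act1 DG_aut_inj DG_aut_surj).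
have M0 : M 0 by rewrite -(subrr e); exact: MB.
have MN u : M u -> M (- u) by rewrite -[- u]sub0r; exact: MB.
have MD u v : M u -> M v -> M (u + v).
  by move=> Mu Mv; rewrite -[v]opprK; apply: MB => //; exact: MN.
have MT u : M u -> M (T u).
  by move=> [a ->]; exists (laurent_t * a); rewrite (laurent_act_t DG_aut_inj DG_aut_surj).
have MTV u : M (T u) -> M u.
  by move=> [a Tu]; exact: (laurent_act_tV DG_aut_inj DG_aut_surj Tu).
have Mz (s : int) u : M u -> M (u *~ s).
  have Mn n : M u -> M (u *+ n).
    by move=> Mu; elim: n => [|n ih]; rewrite ?mulr0n// mulrS; exact: MD.
  by case: s => n Mu; [rewrite -pmulrn|rewrite NegzE mulrNz -pmulrn; apply: MN]; exact: Mn.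
(* If tau 1 = 0 this is the generator; otherwise tau 0 = 0 and e_{tau 1} = L e_0 - e_0. *)
have M1 : M (dcls (cut tau c (tau 1))).
  have [t0|->//] := tau_ends tau_unimodal tau_surj.
  have /andP[/ltW c0 _] := c01.
  have := ctransfer_cut_left tau_unimodal tau_surj S0 c0; rewrite t0 addrC => h.
  have -> : cut tau c (tau 1) = L (cut tau c 0) - cut tau c 0 by rewrite h addrK.
  by rewrite dclsB -DG_aut_dcls; apply: MB => //; exact: MT.
have step a : S a -> M (dcls (cut tau c a)) <-> M (dcls (cut tau c (tau a))).
  move=> Sa; have [s s1 La] := ctransfer_cut_sign Sa; split=> [Ma|Ma].
    have h : M (dcls (cut tau c (tau a)) *~ s).
      have -> : dcls (cut tau c (tau a)) *~ s =
          T (dcls (cut tau c a)) - dcls (cut tau c (tau 1)).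
        by rewrite DG_aut_dcls La raddfD raddfMz /= addrK.
      by apply: MB => //; exact: MT.
    by case: s1 h => ->; rewrite ?mulr1z// mulrNz => /MN; rewrite opprK.
  by apply: MTV; rewrite DG_aut_dcls La raddfD raddfMz; apply: MD => //; exact: Mz.
(* Induction on I_1. In the base case e_0 is the generator, e_1 = 0, and c is reached backwards from
   tau c = 1. *)
have key a : S a -> M (dcls (cut tau c a)).
  move=> Sa; suff [_ h] : S a /\ M (dcls (cut tau c a)) by [].
  move: a Sa; apply: (gen_orbit_min tau_unimodal).
  - by move=> a [Sa Ma]; split; [exact: gen_orbit_tau|exact: (proj1 (step a Sa))].
  - move=> a a01 [Sa Ma]; have Sa' := gen_orbit_preim a01 Sa.
    by split=> //; exact: (proj2 (step a Sa')).
  - have Mc1 : M (dcls (cut tau c 1)) by rewrite cut1// raddf0.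
    move=> a [[->|->]|->]; split=> //.
    by apply: (proj2 (step c Sc)); rewrite tau_crit.
move=> v; have [f ->] := dcls_repr v; have [s hs ->] := cont_int_cut tau_unimodal f.
rewrite -/(M _); elim: s hs => [|p s ih] hs; first by rewrite big_nil raddf0.
rewrite big_cons raddfD raddfMz; apply: MD.
  by apply: Mz; apply: key; apply: hs; exact: mem_head.
by apply: ih => q qs; apply: hs; rewrite in_cons qs orbT.
Qed.

(** * Spans of cuts and jumps *)

Definition cut_span (P : set R) f :=
  exists2 s : seq (R * int), {in s, forall p, P p.1} &
    f = \sum_(p <- s) cut tau c p.1 *~ p.2.

Lemma cut_span_cut (P : set R) a : P a -> cut_span P (cut tau c a).
Proof.
move=> Pa; exists [:: (a, 1)]; last by rewrite big_seq1.
by move=> p; rewrite inE => /eqP ->.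
Qed.

Lemma cut_span0 (P : set R) : cut_span P 0.
Proof. by exists [::]; rewrite ?big_nil. Qed.

Lemma cut_spanD (P : set R) f g : cut_span P f -> cut_span P g -> cut_span P (f + g).
Proof.
move=> [s hs ->] [r hr ->]; exists (s ++ r); rewrite ?big_cat//.
by move=> p; rewrite mem_cat => /orP[/hs|/hr].
Qed.

Lemma cut_spanMz (P : set R) f m : cut_span P f -> cut_span P (f *~ m).
Proof.
move=> [s hs ->]; exists [seq (p.1, p.2 * m) | p <- s].
  by move=> p /mapP[r rs ->]; exact: (hs r rs).
by rewrite big_map mulrz_suml; apply: eq_bigr => p _ /=; rewrite mulrzA.
Qed.

Lemma cut_spanB (P : set R) f g : cut_span P f -> cut_span P g -> cut_span P (f - g).
Proof. by move=> Pf Pg; rewrite -[- g]mulrN1z; apply: cut_spanD => //; exact: cut_spanMz. Qed.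

Lemma cut_span_sub (P Q : set R) f : P `<=` Q -> cut_span P f -> cut_span Q f.
Proof. by move=> PQ [s hs ->]; exists s => // p /hs /PQ. Qed.

Lemma cut_span_ctransfer (P Q : set R) f :
  (forall a, P a -> cut_span Q (L (cut tau c a))) ->
  cut_span P f -> cut_span Q (L f).
Proof.
move=> h [s hs ->]; elim: s hs => [|p s ih] hs.
  by rewrite big_nil raddf0; exact: cut_span0.
rewrite big_cons raddfD raddfMz; apply: cut_spanD.
  by apply: cut_spanMz; apply: h; apply: hs; exact: mem_head.
by apply: ih => q qs; apply: hs; rewrite in_cons qs orbT.
Qed.

(** For a doubled, this reads off the total coefficient of the cut at a in any combination of
    cuts. *)
Definition jump a f : int := f (mkpt S a true) - f (mkpt S a false).

Lemma jumpD a f g : jump a (f + g) = jump a f + jump a g.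
Proof. by rewrite /jump !cont_intD opprD addrACA. Qed.

Lemma jumpMz a f m : jump a (f *~ m) = jump a f * m.
Proof. by rewrite /jump !cont_intMz mulrBl. Qed.

Lemma jump_cut a b : doubled S a -> S b -> jump a (cut tau c b) = (a == b)%:R.
Proof.
move=> da Sb; have a01 := doubled_itvW S01 da.
have /andP[a0 _] := doubled_itv S01 da.
rewrite /jump cutE// /cut_fun /above !collapse_mkpt// !upper_mkpt// da /=.
by case: (ltgtP b a) => //= ->; rewrite (gt_eqF a0).
Qed.

Lemma jump_cut_span (P : set R) a f : doubled S a -> P `<=` S -> ~ P a ->
  cut_span P f -> jump a f = 0.
Proof.
move=> da PS nPa [s hs ->]; elim: s hs => [|p s ih] hs.
  by rewrite big_nil /jump subrr.
rewrite big_cons jumpD jumpMz ih ?addr0; last first.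
  by move=> q qs; apply: hs; rewrite in_cons qs orbT.
have Pp := hs p (mem_head _ _); rewrite jump_cut//; last exact: PS.
by case: eqVneq => [e|_]; rewrite ?mul0r//; case: nPa; rewrite e.
Qed.

Lemma iter_ctransferD n f g : iter n L (f + g) = iter n L f + iter n L g.
Proof. by elim: n => //= n ->; rewrite raddfD. Qed.

Lemma iter_ctransferB n f g : iter n L (f - g) = iter n L f - iter n L g.
Proof. by elim: n => //= n ->; rewrite raddfB. Qed.

Lemma iter_ctransferMz n f m : iter n L (f *~ m) = iter n L f *~ m.
Proof. by elim: n => //= n ->; rewrite raddfMz. Qed.

Lemma iter_ctransfer0 n : iter n L 0 = 0.
Proof. by elim: n => //= n ->; rewrite raddf0. Qed.

Lemma iter_ctransfer_sum n I (r : seq I) (F : I -> cont_int X) :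
  iter n L (\sum_(i <- r) F i) = \sum_(i <- r) iter n L (F i).
Proof.
elim: r => [|i r ih]; rewrite ?big_nil ?iter_ctransfer0// !big_cons.
by rewrite iter_ctransferD ih.
Qed.

Section NotEventuallyPeriodic.
Hypothesis c_aper : ~ eventually_periodic tau c.

Lemma iter_crit_inj i j : iter i tau c = iter j tau c -> i = j.
Proof.
wlog ij : i j / (i < j)%N => [h e|e].
  by case: (ltngtP i j) => // ?; [exact: h|apply/esym/h].
case: c_aper; exists i, (j - i)%N; rewrite subn_gt0; split=> //.
by rewrite subnKC ?(ltnW ij).
Qed.

(** Apart from x_0 = 0 the sequence follows the orbit of c, whose points are distinct. The tail
    avoids 0, since otherwise the orbit would repeat, and avoids 1 = tau c; so the x_n with n > 0
    are doubled and their jumps are available. *)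
Lemma crit_sequence : exists x : nat -> R,
  [/\ x 0%N = 0, (forall n, x n.+2 = tau (x n.+1)), (forall n, S (x n)),
   (forall n, doubled S (x n.+1)) &
   [/\ injective x, L (cut tau c 0) = cut tau c 0 + cut tau c (x 1%N) &
       tau 1 = x 0%N \/ tau 1 = x 1%N]].
Proof.
have /andP[/ltW c0 _] := c01.
have tauc := tau_crit tau_unimodal tau_surj.
have Sit n : S (iter n tau c) by elim: n => //= n; exact: gen_orbit_tau.
(* x_n will be tau^(n + k) c for n > 0. If tau 0 = 0, then k = 1 and x_1 = tau^2 c = tau 1. If tau 1
   = 0, then tau^2 c = 0 is already x_0, so k = 2 and x_1 = tau^3 c = tau 0. *)
have [k [k0 nk0 kz]] : exists k, [/\ (0 < k)%N,
    forall n, iter (n.+1 + k) tau c != 0 &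
    L (cut tau c 0) = cut tau c 0 + cut tau c (iter k.+1 tau c) /\
    (tau 1 = 0 \/ tau 1 = iter k.+1 tau c)].
  have [t0|t1] := tau_ends tau_unimodal tau_surj.
    exists 1%N; split=> // [n|].
      apply/eqP => h; have : iter (n.+1 + 1) tau c = iter (n.+1 + 1).+1 tau c.
        by rewrite iterS h t0.
      by move=> /iter_crit_inj /n_Sn.
    by rewrite ctransfer_cut_left// t0 /= tauc; split=> //; right.
  exists 2%N; split=> // [n|].
    apply/eqP => h; have : iter (n.+1 + 2) tau c = iter 2 tau c by rewrite h /= tauc.
    by move=> /iter_crit_inj; rewrite addSn addn2.
  by rewrite ctransfer_cut_left// /= tauc t1 addrC; split=> //; left.
pose x n := if n is n'.+1 then iter (n + k) tau c else 0.
exists x; split=> // [[//|n]|n|]; first exact: Sit.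
  rewrite /x doubledE (asboolT (Sit _)) nk0 /=; apply/eqP => h.
  have /iter_crit_inj : iter (n + k).+1 tau c = iter 1 tau c by rewrite iterS h /= tauc.
  by move: k0; lia.
case: kz => kz1 kz2; split=> // [[|n] [|m]//=].
- by move=> /esym/eqP; rewrite -[tau _]/(iter (m.+1 + k) tau c) (negbTE (nk0 m)).
- by move=> /eqP; rewrite -[tau _]/(iter (n.+1 + k) tau c) (negbTE (nk0 n)).
- rewrite -[tau _]/(iter (n.+1 + k) tau c) -[RHS]/(iter (m.+1 + k) tau c).
  by move=> /iter_crit_inj /addIn.
Qed.

Lemma poly_act_cut0_eq0 (p : {poly int}) : poly_act T p e = 0 -> p = 0.
Proof.
have [x [x0 xS Sx dx [x_inj Lx0 t1x]]] := crit_sequence.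
pose P n := [set a | exists2 j, (j < n)%N & a = x j].
have PS n : P n `<=` S by move=> a [j _ ->].
have Pmono n m : (n <= m)%N -> P n `<=` P m.
  by move=> nm a [j jn ->]; exists j => //; exact: leq_trans nm.
have Px n m : (n < m)%N -> cut_span (P m) (cut tau c (x n)).
  by move=> nm; apply: cut_span_cut; exists n.
have Lspan n a : P n.+1 a -> cut_span (P n.+2) (L (cut tau c a)).
  move=> [[|j] jn ->].
    by rewrite x0 Lx0; apply: cut_spanD; [rewrite -x0|]; exact: Px.
  have [s _ ->] := ctransfer_cut_sign (Sx j.+1).
  apply: cut_spanD; first by apply: cut_spanMz; rewrite -xS; exact: Px.
  by case: t1x => ->; exact: Px.
(* Each application of L moves the leading cut one step along the sequence, up to sign, while the
   other terms stay among earlier cuts. *)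
have lead n : exists2 s : int, s != 0 & exists2 g, cut_span (P n.+1) g &
    iter n.+1 L (cut tau c 0) = cut tau c (x n.+1) *~ s + g.
  elim: n => [|n [s s0 [g Pg Lg]]].
    exists 1 => //; exists (cut tau c 0); first by rewrite -x0; exact: Px.
    by rewrite /= Lx0 addrC.
  have [r r1 Lx] := ctransfer_cut_sign (Sx n.+1).
  exists (r * s); first by rewrite mulf_neq0//; case: r1 => ->.
  exists (cut tau c (tau 1) *~ s + L g).
    apply: cut_spanD; last by apply: cut_span_ctransfer Pg; exact: Lspan.
    by apply: cut_spanMz; case: t1x => ->; exact: Px.
  by rewrite iterS Lg raddfD raddfMz /= Lx xS mulrzDl mulrzA addrA.
move=> pe0; apply/eqP/negPn/negP => p0.
pose u := \sum_(i < size p) iter i L (cut tau c 0) *~ p`_i.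
have : dcls u = dcls 0.
  rewrite raddf0 -pe0 /poly_act raddf_sum; apply: eq_bigr => i _.
  rewrite raddfMz; congr (_ *~ _).
  by elim: (nat_of_ord i) => //= k <-; rewrite DG_aut_dcls.
(* One more L makes every exponent positive, since [lead] describes only the iterates from the first
   on. *)
move=> /dclsP[n /(congr1 L)]; rewrite -!iterS iter_ctransfer0 /u.
have [N sp] : exists N, size p = N.+1.
  by case: (size p) (size_poly_eq0 p) => [|N]; [rewrite (negbTE p0)|exists N].
rewrite iter_ctransfer_sum sp big_ord_recr /= -!iterS.
(* This cut occurs only in the term of degree N, so its jump is the leading coefficient of [p] times
   a nonzero integer. *)
move=> /(congr1 (jump (x (n + N).+1))).
rewrite jumpD iter_ctransferMz jumpMz -iterD addSn.
have nP : ~ P (n + N).+1 (x (n + N).+1).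
  by move=> [j jn /x_inj jE]; rewrite -jE ltnn in jn.
have [s s0 [g Pg ->]] := lead (n + N)%N.
rewrite jumpD jumpMz (jump_cut_span (dx _) (PS _) nP Pg) jump_cut// eqxx mul1r addr0.
rewrite (jump_cut_span (dx _) (PS (n + N).+1) nP); last first.
  apply: (big_ind (cut_span (P (n + N).+1))) => [|f g'|i _].
  - exact: cut_span0.
  - exact: cut_spanD.
  rewrite -iterS iter_ctransferMz -iterD addSn; apply: cut_spanMz.
  have [r _ [h Ph ->]] := lead (n + i)%N.
  have nNi : ((n + i).+1 < (n + N).+1)%N by rewrite ltnS ltn_add2l.
  apply: cut_spanD; first by apply: cut_spanMz; exact: Px.
  exact: cut_span_sub (Pmono _ _ (ltnW nNi)) Ph.
rewrite add0r /jump subrr => /eqP; rewrite mulf_eq0 (negbTE s0) /=.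
have -> : N = (size p).-1 by rewrite sp.
by rewrite -/(lead_coef p) lead_coef_eq0 (negbTE p0).
Qed.

(** The isomorphism is the inverse of l |-> l e, onto by cyclicity and injective because e has no
    annihilator. *)
Theorem DG_laurent : exists phi : {additive DG tau c -> laurent},
  bijective phi /\ forall v, phi (T v) = laurent_t * phi v.
Proof.
pose psi (l : laurent) := laurent_act T l e.
have psiB : zmod_morphism psi by move=> l m; exact: (laurent_actB DG_aut_inj DG_aut_surj).
have psi_inj : injective psi.
  move=> l m lm; apply/eqP; rewrite -subr_eq0; apply/eqP.
  apply: (laurent_act_eq0 DG_aut_inj DG_aut_surj poly_act_cut0_eq0).
  by rewrite -/(psi _) psiB lm subrr.
have surj v : exists l, psi l = v by have [l ->] := DG_cyclic v; exists l.
pose phi v := sval (cid (surj v)).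
have phiK v : psi (phi v) = v by rewrite /phi; case: cid.
have psiK l : phi (psi l) = l by apply: psi_inj; rewrite phiK.
have phiB : zmod_morphism phi.
  by move=> u v; apply: psi_inj; rewrite psiB !phiK.
pose phiM := GRing.isZmodMorphism.Build _ _ phi phiB.
pose phiA : {additive DG tau c -> laurent} := HB.pack phi phiM.
exists phiA; split; first by exists psi.
move=> v; apply: psi_inj; rewrite phiK /psi (laurent_act_t DG_aut_inj DG_aut_surj).
by rewrite -/(psi _) phiK.
Qed.

End NotEventuallyPeriodic.
End DimensionModule.

(** * Markov partitions *)

Lemma exists_last_true (P : pred nat) n : P 0%N -> ~~ P n ->
  exists j, [/\ (j < n)%N, P j & ~~ P j.+1].
Proof.
elim: n => [->//|n ih] P0 nP; have [Pn|/(ih P0) [j [jn Pj Pj1]]] := boolP (P n).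
  by exists n.
by exists j; split=> //; exact: ltnW.
Qed.

Section IncreasingSequence.
Context {R : realType}.
Variables (b : nat -> R) (q : nat).
Hypothesis b_incr : forall i, (i < q)%N -> b i < b i.+1.

Lemma increasing_lt i j : (i < j)%N -> (j <= q)%N -> b i < b j.
Proof.
elim: j => // j ih; rewrite ltnS leq_eqVlt => /orP[/eqP ->|ij] jq; first exact: b_incr.
by apply: lt_trans (ih ij (ltnW jq)) (b_incr jq).
Qed.

Lemma increasing_le i j : (i <= j)%N -> (j <= q)%N -> b i <= b j.
Proof. by rewrite leq_eqVlt => /orP[/eqP ->//|ij] jq; rewrite ltW ?increasing_lt. Qed.

Lemma increasing_ltP i j : (i <= q)%N -> b i < b j -> (i < j)%N.
Proof. by move=> iq; apply: contraTT; rewrite -leqNgt -leNgt => ji; exact: increasing_le. Qed.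

Lemma increasing_leP i j : (i <= q)%N -> b i <= b j -> (i <= j)%N.
Proof. by move=> iq; apply: contraTT; rewrite -ltnNge -ltNge => ji; exact: increasing_lt. Qed.

End IncreasingSequence.

Section MarkovPartition.
Local Open Scope classical_set_scope.
Context {R : realType}.

Lemma closure_itvoo (a b : R) : a < b -> closure `]a, b[ = `[a, b].
Proof.
move=> ab; apply/seteqP; split; first exact: itv_closure.
move=> x /=; rewrite in_itv /= => /andP[ax xb].
have [xa|xna] := eqVneq x a.
  move=> U /=; rewrite xa => aU.
  have : \forall y \near a^'+, (`]a, b[ `&` U) y.
    near=> y; split; first by rewrite /= in_itv /=; apply/andP; split; near: y;
      [exact: nbhs_right_gt|exact: nbhs_right_lt].
    by near: y; exact: (@cvg_within _ (nbhs a)).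
  by move=> /filter_ex [y Hy]; exists y.
have [xeb|xnb] := eqVneq x b.
  move=> U /=; rewrite xeb => bU.
  have : \forall y \near b^'-, (`]a, b[ `&` U) y.
    near=> y; split; first by rewrite /= in_itv /=; apply/andP; split; near: y;
      [exact: nbhs_left_gt|exact: nbhs_left_lt].
    by near: y; exact: (@cvg_within _ (nbhs b)).
  by move=> /filter_ex [y Hy]; exists y.
by apply: subset_closure; rewrite /= in_itv /= !lt_neqAle eq_sym xna ax xnb.
Unshelve. all: by end_near. Qed.

Variables (tau : R -> R) (c : R).
Hypothesis tau_unimodal : unimodal tau c.
Hypothesis tau_surj : surjective_on_I tau.
Notation S := (I1 tau c).

Let c01 : 0 < c < 1. Proof. by case: tau_unimodal. Qed.
Let S01 := gen_orbit_itv tau_unimodal.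
Let S0 : S 0 := @gen_orbit0 _ tau c.
Let Sc : S c := @gen_orbitc _ tau c.
Let S1 : S 1 := @gen_orbit1 _ tau c.

Let ivt (a b v : R) : 0 <= a -> a < b -> b <= 1 ->
  Num.min (tau a) (tau b) <= v <= Num.max (tau a) (tau b) ->
  exists2 x, a <= x <= b & tau x = v.
Proof.
move=> a0 ab b1 hv; have [|x] := @IVT R tau a b v (ltW ab) _ hv.
  apply: continuous_subspaceW (tau_cont tau_unimodal) => x /=.
  by rewrite !in_itv /= => /andP[h1 h2]; rewrite (le_trans a0 h1) (le_trans h2 b1).
by rewrite in_itv; exists x.
Qed.

Lemma tau_itvoo_left a b : 0 <= a -> a < b -> b <= c ->
  tau @` `]a, b[ = `]tau a, tau b[.
Proof.
move=> a0 ab bc; have /andP[_ /ltW c1] := c01.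
apply/seteqP; split=> [y [x xab <-]|v]; [move: xab|]; rewrite /= !in_itv /= => /andP[].
  move=> ax xb.
  by rewrite !(tau_incr tau_unimodal)// (le_trans a0 (ltW ax), le_trans (ltW xb) bc).
move=> av vb; have tab : tau a < tau b by rewrite (tau_incr tau_unimodal).
have [||x /andP[ax xb] xv] := @ivt a b v a0 ab; first exact: le_trans bc c1.
  by rewrite min_l ?max_r ?(ltW tab)// !ltW.
exists x => //; rewrite in_itv /= !lt_neqAle ax xb !andbT.
apply/andP; split; apply/eqP => e; first by move: av; rewrite -xv e ltxx.
by move: vb; rewrite -xv e ltxx.
Qed.

Lemma tau_itvoo_right a b : c <= a -> a < b -> b <= 1 ->
  tau @` `]a, b[ = `]tau b, tau a[.
Proof.
move=> a0 ab bc; have /andP[/ltW c0 _] := c01.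
apply/seteqP; split=> [y [x xab <-]|v]; [move: xab|]; rewrite /= !in_itv /= => /andP[].
  move=> ax xb.
  by rewrite !(tau_decr tau_unimodal)// (le_trans a0 (ltW ax), le_trans (ltW xb) bc).
move=> av vb; have tab : tau b < tau a by rewrite (tau_decr tau_unimodal).
have [|x /andP[ax xb] xv] := @ivt a b v (le_trans c0 a0) ab bc.
  by rewrite min_r ?max_l ?(ltW tab)// !ltW.
exists x => //; rewrite in_itv /= !lt_neqAle ax xb !andbT.
apply/andP; split; apply/eqP => e; first by move: vb; rewrite -xv e ltxx.
by move: av; rewrite -xv e ltxx.
Qed.

Lemma itv_bigcup_increasing (b : nat -> R) q (i k : nat) :
  (forall j, (j < q)%N -> b j < b j.+1) -> (i < k)%N -> (k <= q)%N ->
  `[b i, b k] = \bigcup_(j in [set j | (i <= j < k)%N]) `[b j, b j.+1].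
Proof.
move=> bi ik kq; apply/seteqP; split=> [x /=|x [j /= /andP[ij jk]]]; last first.
  rewrite /= !in_itv /= => /andP[h1 h2].
  rewrite (le_trans (increasing_le bi ij _) h1) ?(leq_trans (ltnW jk))//.
  by rewrite (le_trans h2 (increasing_le bi jk _)).
rewrite in_itv /= => /andP[ix xk].
have [xe|xn] := eqVneq x (b k).
  exists k.-1 => /=; first by move: ik; lia.
  rewrite in_itv /= prednK ?(leq_trans _ ik)// xe lexx andbT.
  exact: (increasing_le bi (leq_pred k) kq).
have xk' : x < b k by rewrite lt_neqAle xn.
have [|| j [jk jx xj]] := @exists_last_true (fun j => b (i + j)%N <= x) (k - i).
- by rewrite addn0.
- by rewrite subnKC ?(ltnW ik)// -ltNge.
exists (i + j)%N => /=; first by rewrite leq_addr /=; move: jk; lia.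
by rewrite in_itv /= jx ltW// ltNge -addnS.
Qed.

Theorem eventually_periodic_markov : eventually_periodic tau c -> markov_map tau c.
Proof.
move=> [n [p [p0 per]]].
have tauc := tau_crit tau_unimodal tau_surj.
(* The partition consists of 0, 1 and the orbit of c, which is exhausted by its first n + p
   points. *)
pose l := [:: 0, 1 & [seq iter k tau c | k <- iota 0 (n + p)]].
have lit k : iter k tau c \in l.
  have [m] := ubnP k; elim: m k => // m ih k; rewrite ltnS => km.
  have [kn|nk] := ltnP k (n + p).
    rewrite !in_cons; apply/or3P/Or33/mapP; exists k => //; rewrite mem_iota; lia.
  suff -> : iter k tau c = iter (k - p) tau c by apply: ih; lia.
  rewrite -(subnK nk) iterD per -iterD; congr (iter _ tau c); lia.
have lS x : x \in l -> S x.
  rewrite !in_cons => /or3P[/eqP ->//|/eqP ->//|/mapP[k _ ->]].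
  by elim: k => //= k; exact: gen_orbit_tau.
(* For the two ends: tau 1 = tau^2 c, and tau 0 is either 0 or, when tau 1 = 0, tau^3 c. *)
have ltau x : x \in l -> tau x \in l.
  rewrite !in_cons => /or3P[/eqP ->|/eqP ->|/mapP[k _ ->]].
  - have [->|t1] := tau_ends tau_unimodal tau_surj; first by rewrite eqxx.
    by have := lit 3; rewrite /= tauc t1 !in_cons.
  - by have := lit 2; rewrite /= tauc !in_cons.
  - by have := lit k.+1; rewrite /= !in_cons.
pose s := sort <=%R (undup l).
pose q := (size s).-1.
pose b := nth 0 s.
have ms x : (x \in s) = (x \in l) by rewrite mem_sort mem_undup.
have s0 : (0 < size s)%N by case: (s) (ms 0) => //; rewrite in_nil in_cons eqxx.
have sq : size s = q.+1 by rewrite /q prednK.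
have bl i : (i <= q)%N -> b i \in l by move=> iq; rewrite -ms mem_nth// sq ltnS.
have lb x : x \in l -> exists2 i, (i <= q)%N & b i = x.
  rewrite -ms => xs; exists (index x s); last exact: nth_index.
  by rewrite -ltnS -sq index_mem.
have bi i : (i < q)%N -> b i < b i.+1.
  move=> iq; rewrite /b lt_sorted_ltn_nth// ?inE ?sq ?ltnS ?(ltnW iq)//.
  by rewrite sort_lt_sorted undup_uniq.
have bS i : (i <= q)%N -> S (b i) by move=> /bl /lS.
have b01 i : (i <= q)%N -> 0 <= b i <= 1 by move=> /bS /S01.
have b0 : b 0%N = 0.
  have [i iq bi0] := lb 0 (mem_head _ _).
  case: i iq bi0 => // i iq bi0; have := increasing_lt bi (ltn0Sn i) iq.
  by rewrite bi0 ltNge; have /andP[-> _] := b01 0%N isT.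
have bq : b q = 1.
  have [|i iq bi1] := lb 1; first by rewrite !in_cons eqxx orbT.
  move: iq; rewrite leq_eqVlt => /predU1P[<-//|iq].
  have := increasing_lt bi iq (leqnn _).
  by rewrite bi1 ltNge; have /andP[_ ->] := b01 q (leqnn q).
have [m mq bm] := lb c (lit 0%N).
have side i : (i < q)%N -> b i.+1 <= c \/ c <= b i.
  move=> iq; rewrite -bm; have [im|mi] := ltnP i m; [left|right].
    exact: (increasing_le bi im mq).
  exact: (increasing_le bi mi (ltnW iq)).
exists q, b; split=> //.
- move=> i iq; have /andP[bi0 _] := b01 i (ltnW iq); have /andP[_ bi1] := b01 i.+1 iq.
  case: (side i iq) => [h|h]; [left|right] => x y; rewrite !inE /= !in_itv /=
    => /andP[x1 x2] /andP[y1 y2]; rewrite le_eqVlt => /predU1P[->//|xy]; rewrite ltW//.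
    by rewrite (tau_incr tau_unimodal)// ?(le_trans _ h) ?(ltW y2)// (le_trans bi0) ?ltW.
  by rewrite (tau_decr tau_unimodal)// ?(le_trans h) ?(ltW y1)// (le_trans _ bi1) ?ltW.
- move=> i iq; have /andP[bi0 _] := b01 i (ltnW iq); have /andP[_ bi1] := b01 i.+1 iq.
  suff [j [k [jk kq ->]]] : exists j k, [/\ (j < k)%N, (k <= q)%N &
      closure (tau @` `]b i, b i.+1[) = `[b j, b k]].
    exists [set x | (j <= x < k)%N]; last exact: (itv_bigcup_increasing bi jk kq).
    by move=> x /= /andP[_ xk]; exact: leq_trans kq.
  have [j jq bj] := lb _ (ltau _ (bl i (ltnW iq))).
  have [k kq bk] := lb _ (ltau _ (bl i.+1 iq)).
  case: (side i iq) => h.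
    have t : tau (b i) < tau (b i.+1) by rewrite (tau_incr tau_unimodal)// bi.
    exists j, k; split=> //; first by apply: (increasing_ltP bi jq); rewrite bj bk.
    by rewrite tau_itvoo_left ?bi// closure_itvoo// bj bk.
  have t : tau (b i.+1) < tau (b i) by rewrite (tau_decr tau_unimodal)// bi.
  exists k, j; split=> //; first by apply: (increasing_ltP bi kq); rewrite bj bk.
  by rewrite tau_itvoo_right ?bi// closure_itvoo// bj bk.
(* No iteration is required: the partition already contains C. *)
- exists 0%N => _ [x Cx <-] /=; suff [i iq bx] : exists2 i, (i <= q)%N & b i = x by exists i.
  apply: lb; case: Cx => [[->|->]|->]; rewrite ?mem_head//; first exact: (lit 0%N).
  by rewrite !in_cons eqxx orbT.
Qed.

End MarkovPartition.

(** * The triple of the incidence matrix *)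

Section MarkovTriple.
Local Open Scope classical_set_scope.
Context {R : realType}.
Variables (tau : R -> R) (c : R).
Hypothesis tau_unimodal : unimodal tau c.
Hypothesis tau_surj : surjective_on_I tau.
Variables (q : nat) (b : nat -> R).
Hypothesis b_markov : markov_partition tau c q b.
Notation S := (I1 tau c).
Notation X := (disc_X tau c).
Notation sg := (sigma tau c).
Notation L := (@ctransfer R tau c).
Notation T := (DG_aut tau c).
Notation A := (incidence_matrix tau c q b).
Implicit Types (x y z : X) (f g : cont_int X) (v w : 'rV[int]_q).

Let c01 : 0 < c < 1. Proof. by case: tau_unimodal. Qed.
Let S01 := gen_orbit_itv tau_unimodal.
Let S0 : S 0 := @gen_orbit0 _ tau c.
Let Sc : S c := @gen_orbitc _ tau c.
Let S1 : S 1 := @gen_orbit1 _ tau c.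

Let b0 : b 0%N = 0. Proof. by case: b_markov => -[]. Qed.
Let bq : b q = 1. Proof. by case: b_markov => -[]. Qed.
Let b_incr i : (i < q)%N -> b i < b i.+1. Proof. by case: b_markov => -[_ _ h] *; exact: h. Qed.
Let bS i : (i <= q)%N -> S (b i). Proof. by case: b_markov => _ h *; exact: h. Qed.
Let b01 i : (i <= q)%N -> 0 <= b i <= 1. Proof. by move=> /bS /S01. Qed.

Definition endpoints : set R := [set a | exists2 i, (i <= q)%N & a = b i].

(** Otherwise c is interior to a cell, and tau is smaller than tau c on both sides of it, so it is
    not monotonic there. *)
Lemma endpoint_crit : endpoints c.
Proof.
have /andP[c0 c1] := c01.
have [||j [jq bj bj1]] := @exists_last_true (fun j => b j <= c) q.
- by rewrite b0 ltW.
- by rewrite bq -ltNge.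
have [e|nc] := eqVneq c (b j); first by exists j => //; exact: ltnW.
have bjc : b j < c by rewrite lt_neqAle eq_sym nc.
move: bj1; rewrite -ltNge => bj1.
have /andP[bj0 _] := b01 (ltnW jq); have /andP[_ bj2] := b01 jq.
have [_ _ /(_ j jq) mono _ _] := b_markov.
pose x := (b j + c) / 2; pose y := (c + b j.+1) / 2.
have [x1 x2 y1 y2] : [/\ b j < x, x < c, c < y & y < b j.+1].
  by rewrite /x /y; split; lra.
have tx : tau x < tau c by apply: (tau_incr tau_unimodal) => //; lra.
have ty : tau y < tau c by apply: (tau_decr tau_unimodal) => //; lra.
have inI (z : R) : b j < z < b j.+1 -> z \in (`]b j, b j.+1[ : set R).
  by rewrite inE /= in_itv.
case: mono => h.
  have := h c y; rewrite !inI ?bjc ?bj1 ?(lt_trans bjc y1) ?y2// => /(_ isT isT (ltW y1)).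
  by rewrite leNgt ty.
have := h c x; rewrite !inI ?bjc ?bj1 ?x1 ?(lt_trans x2 bj1)// => /(_ isT isT (ltW x2)).
by rewrite leNgt tx.
Qed.

Lemma cell_side i : (i < q)%N -> b i.+1 <= c \/ c <= b i.
Proof.
move=> iq; have [m mq ->] := endpoint_crit; have [im|mi] := ltnP i m; [left|right].
  exact: (increasing_le b_incr im mq).
exact: (increasing_le b_incr mi (ltnW iq)).
Qed.

(** The cell of the union that contains u cannot extend to the left of u, so it starts there;
    likewise at v. *)
Lemma endpoints_bigcup (J : set nat) (u v : R) : u < v -> J `<=` `I_q ->
  `[u, v] = \bigcup_(j in J) `[b j, b j.+1] -> endpoints u /\ endpoints v.
Proof.
move=> uv JI e.
have mem (a : R) : u <= a <= v <-> exists2 j, J j & b j <= a <= b j.+1.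
  have := congr1 (@^~ a) e; rewrite /= in_itv /= => ->.
  by split=> -[j Jj]; rewrite /= ?in_itv /= => h; exists j => //=; rewrite ?in_itv.
have [j Jj /andP[ju uj]] : exists2 j, J j & b j <= u <= b j.+1.
  by apply/mem; rewrite lexx ltW.
have [k Jk /andP[kv vk]] : exists2 j, J j & b j <= v <= b j.+1.
  by apply/mem; rewrite lexx ltW.
have jq : (j < q)%N := JI _ Jj; have kq : (k < q)%N := JI _ Jk.
have /mem/andP[uj' _] : exists2 i, J i & b i <= b j <= b i.+1.
  by exists j; rewrite ?lexx ?ltW// b_incr.
have /mem/andP[_ kv'] : exists2 i, J i & b i <= b k.+1 <= b i.+1.
  by exists k; rewrite ?lexx ?andbT ?ltW// b_incr.
split; first by exists j; [exact: ltnW|apply/eqP; rewrite eq_le uj' ju].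
by exists k.+1 => //; apply/eqP; rewrite eq_le vk kv'.
Qed.

Lemma tau_cell i : (i < q)%N -> endpoints (tau (b i)) /\ endpoints (tau (b i.+1)).
Proof.
move=> iq; have [_ _ _ /(_ i iq) [J JI] e _] := b_markov; move: e.
have /andP[bi0 _] := b01 (ltnW iq); have /andP[_ bi1] := b01 iq.
have bi := b_incr iq.
case: (cell_side iq) => h.
  rewrite (tau_itvoo_left tau_unimodal) ?closure_itvoo//; last by rewrite (tau_incr tau_unimodal).
  by apply: endpoints_bigcup => //; rewrite (tau_incr tau_unimodal).
rewrite (tau_itvoo_right tau_unimodal) ?closure_itvoo//; last by rewrite (tau_decr tau_unimodal).
move=> e; apply/and_comm; apply: endpoints_bigcup e => //.
by rewrite (tau_decr tau_unimodal).
Qed.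

Lemma markov_q_gt0 : (0 < q)%N.
Proof.
rewrite lt0n; apply/eqP => q0; move: bq; rewrite q0 b0 => /eqP.
by rewrite eq_sym oner_eq0.
Qed.

Lemma endpoints_tau a : endpoints a -> endpoints (tau a).
Proof.
move=> [i iq ->]; case: i iq => [_|i iq]; first by case: (tau_cell markov_q_gt0).
by case: (tau_cell iq).
Qed.

Lemma endpoints_gen_orbit : endpoints `<=` S.
Proof. by move=> a [i iq ->]; exact: bS. Qed.

Lemma endpoint0 : endpoints 0. Proof. by exists 0%N. Qed.
Lemma endpoint1 : endpoints 1. Proof. by exists q. Qed.

Lemma cut_span_endpoints_ctransfer f :
  cut_span endpoints f -> cut_span endpoints (L f).
Proof.
apply: cut_span_ctransfer => // a Ba.
have [s _ ->] := ctransfer_cut_sign tau_unimodal tau_surj (endpoints_gen_orbit Ba).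
apply: cut_spanD; first apply: cut_spanMz; apply: cut_span_cut.
  exact: endpoints_tau.
by apply: endpoints_tau; exact: endpoint1.
Qed.

Lemma cut_span_endpoints_iter n f :
  cut_span endpoints f -> cut_span endpoints (iter n L f).
Proof. by move=> Bf; elim: n => //= n; exact: cut_span_endpoints_ctransfer. Qed.

(** The points a whose cut is eventually absorbed are closed under images and preimages: L e_a is
    e_{tau a} up to sign plus e_{tau 1}, and the latter stays in the invariant span. *)
Lemma cut_span_eventually f : exists n, cut_span endpoints (iter n L f).
Proof.
have mono n m g : (n <= m)%N -> cut_span endpoints (iter n L g) ->
    cut_span endpoints (iter m L g).
  move=> nm; rewrite -(subnK nm) iterD; exact: cut_span_endpoints_iter.
have B1 n : cut_span endpoints (iter n L (cut tau c (tau 1))).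
  apply: cut_span_endpoints_iter; apply: cut_span_cut.
  by apply: endpoints_tau; exact: endpoint1.
have key a : S a -> exists n, cut_span endpoints (iter n L (cut tau c a)).
  move=> Sa; suff [] : S a /\ exists n, cut_span endpoints (iter n L (cut tau c a)) by [].
  move: a Sa; apply: (gen_orbit_min tau_unimodal).
  - move=> a [Sa [n Bn]]; split; first exact: gen_orbit_tau.
    exists n; have [s s1 La] := ctransfer_cut_sign tau_unimodal tau_surj Sa.
    have := cut_spanB (cut_span_endpoints_ctransfer Bn) (B1 n).
    rewrite -iterS iterSr La iter_ctransferD// addrK iter_ctransferMz//.
    by case: s1 => ->; rewrite ?mulr1z// => /(@cut_spanMz _ _ _ _ _ (-1)); rewrite -mulrzA.
  - move=> a a01 [Sta [n Bn]]; have Sa := gen_orbit_preim a01 Sta; split=> //.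
    exists n.+1; have [s _ La] := ctransfer_cut_sign tau_unimodal tau_surj Sa.
    rewrite iterSr La iter_ctransferD// iter_ctransferMz//.
    by apply: cut_spanD => //; exact: cut_spanMz.
  - move=> a Ca; split; first exact: gen_orbit_crit.
    exists 0%N; apply: cut_span_cut.
    by case: Ca => [[->|->]|->]; [exact: endpoint0|exact: endpoint_crit|exact: endpoint1].
have [s hs ->] := cont_int_cut tau_unimodal f.
elim: s hs => [|p s ih] hs; first by exists 0%N; rewrite big_nil; exact: cut_span0.
have [n Bn] := key _ (hs p (mem_head _ _)).
have [|m Bm] := ih; first by move=> r rs; apply: hs; rewrite in_cons rs orbT.
exists (n + m)%N; rewrite big_cons iter_ctransferD// iter_ctransferMz//.
apply: cut_spanD; first by apply: cut_spanMz; apply: mono Bn; exact: leq_addr.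
by apply: mono Bm; exact: leq_addl.
Qed.

(** * Cells of the partition and their indicators as a basis *)

Definition in_cell k x := above (b k) x && ~~ above (b k.+1) x.

Definition cell_indic k : cont_int X := cut tau c (b k) - cut tau c (b k.+1).

(** The sample point of a cell at which coordinates are read. *)
Definition cell_pt k : X := mkpt S (b k) true.

Lemma in_cell_exists x : exists2 k, (k < q)%N & in_cell k x.
Proof.
have [||k [kq h1 h2]] := @exists_last_true (fun j => above (b j) x) q.
- by rewrite b0 above0.
- by rewrite bq (above1 S01).
by exists k => //; rewrite /in_cell h1.
Qed.

(** A cut at a partition point does not split any cell; hence functions in the span are constant on
    cells. *)
Lemma above_in_cell a k x : endpoints a -> (k < q)%N -> in_cell k x ->
  above a x = (a <= b k).
Proof.
move=> [m mq ->] kq /andP[ak nak]; have [mk|km] := leqP m k.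
  have h : b m <= b k by exact: (increasing_le b_incr mk (ltnW kq)).
  by rewrite h (above_le h ak).
rewrite leNgt (increasing_lt b_incr km mq) /=.
apply/negbTE; apply: contra nak; apply: above_le.
exact: (increasing_le b_incr km mq).
Qed.

Lemma in_cell_pt k : (k < q)%N -> in_cell k (cell_pt k).
Proof.
move=> kq; have k01 := b01 (ltnW kq); have bk := b_incr kq.
have /andP[_ k1] := b01 kq; have bk1 : b k < 1 by exact: lt_le_trans bk k1.
have /andP[k0 _] := k01; have bk0 : 0 < b k.+1 by exact: le_lt_trans k0 bk.
rewrite /in_cell /above /cell_pt !collapse_mkpt// !upper_mkpt//.
rewrite ltxx eqxx (gt_eqF bk) ltNge (ltW bk) /= andbT doubledE.
by rewrite (asboolT (bS (ltnW kq))) (lt_eqF bk1) andbT /=; case: eqVneq.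
Qed.

Lemma cut_span_in_cell g k x : cut_span endpoints g -> (k < q)%N -> in_cell k x ->
  g x = g (cell_pt k).
Proof.
move=> [s hs ->] kq kx; rewrite !cont_int_sum; apply: eq_big_seq => p /hs Bp.
rewrite !cont_intMz !cutE//; try exact: endpoints_gen_orbit.
by rewrite /cut_fun !(@above_in_cell _ k)// in_cell_pt.
Qed.

Lemma cell_indicE k x : (k < q)%N -> cell_indic k x = (in_cell k x)%:R.
Proof.
move=> kq; rewrite /cell_indic cont_intB !cutE//; try by apply: bS => //; exact: ltnW.
rewrite /cut_fun /in_cell.
have := @above_le _ _ _ (b k) (b k.+1) x (ltW (b_incr kq)).
by case: (above (b k.+1) x) => [->|_] //; case: (above (b k) x).
Qed.

Lemma in_cell_uniq j k x : (j < q)%N -> (k < q)%N -> in_cell k x ->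
  in_cell j x = (j == k).
Proof.
move=> jq kq kx; rewrite /in_cell !(@above_in_cell _ k)//; [|by exists j.+1|by exists j => //; exact: ltnW].
apply/idP/eqP => [/andP[h1]|->]; last by rewrite lexx -ltNge b_incr.
rewrite -ltNge => h2; apply/eqP; rewrite eqn_leq.
rewrite (increasing_leP b_incr (ltnW jq) h1) -ltnS.
exact: (increasing_ltP b_incr (ltnW kq) h2).
Qed.

Definition cell_comb v : cont_int X := \sum_(j < q) cell_indic j *~ v 0 j.

Lemma cell_combE v (k : 'I_q) x : in_cell k x -> cell_comb v x = v 0 k.
Proof.
move=> kx; rewrite /cell_comb cont_int_sum (bigD1 k)//= cont_intMz cell_indicE// kx mul1r.
rewrite big1 ?addr0// => j jk; rewrite cont_intMz cell_indicE//.
by rewrite (in_cell_uniq _ _ kx)// val_eqE (negbTE jk) mul0r.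
Qed.

Lemma cell_comb_pt v (k : 'I_q) : cell_comb v (cell_pt k) = v 0 k.
Proof. by apply: cell_combE; exact: in_cell_pt. Qed.

Lemma cell_comb_inj : injective cell_comb.
Proof. by move=> v w vw; apply/rowP => k; rewrite -!cell_comb_pt vw. Qed.

Lemma cell_combB v w : cell_comb (v - w) = cell_comb v - cell_comb w.
Proof.
by rewrite /cell_comb -sumrB; apply: eq_bigr => j _; rewrite !mxE mulrzBr.
Qed.

Lemma cut_span_cell_indic k : (k < q)%N -> cut_span endpoints (cell_indic k).
Proof.
by move=> kq; apply: cut_spanB; apply: cut_span_cut; [exists k => //; exact: ltnW|exists k.+1].
Qed.

Lemma cut_span_cell_comb v : cut_span endpoints (cell_comb v).
Proof.
apply: (big_ind (cut_span endpoints)) => [|f g|j _]; first exact: cut_span0.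
  exact: cut_spanD.
by apply: cut_spanMz; exact: cut_span_cell_indic.
Qed.

Lemma cell_comb_span g : cut_span endpoints g ->
  g = cell_comb (\row_j g (cell_pt j)).
Proof.
move=> Bg; apply: cont_int_eq => x; have [k kq kx] := in_cell_exists x.
by rewrite (@cell_combE _ (Ordinal kq))// mxE (cut_span_in_cell Bg kq kx).
Qed.

(** Nonnegative terms cannot cancel in a fibre sum. This translates the images under sigma in the
    incidence matrix into values of L. *)
Lemma image_transfer f y : (forall x, 0 <= f x) ->
  (exists2 x, f x != 0 & sg x = y) <-> L f y != 0.
Proof.
move=> f0; rewrite ctransferE// transferE//.
have l0 : 0 <= left_sum f y by rewrite /left_sum; case: pselect.
have r0 : 0 <= right_sum f y by rewrite /right_sum; case: pselect.
split=> [[x fx <-]|].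
  have fx0 : 0 < f x by rewrite lt_neqAle eq_sym fx f0.
  rewrite gt_eqF//; have [ax|ax] := boolP (above c x).
    by rewrite right_sumE//; apply: ltr_wpDl => //; rewrite /left_sum; case: pselect.
  by rewrite left_sumE//; apply: ltr_pwDl => //; rewrite /right_sum; case: pselect.
rewrite paddr_eq0// negb_and => /orP[]; rewrite /left_sum /right_sum; case: pselect => //.
all: by move=> h; case: cid2 => x /= _ xy fx; exists x.
Qed.

(** The left side is constant on cells, so the inclusion defining the matrix entry can be tested at
    [cell_pt j], where it says that the value is nonzero. *)
Lemma ctransfer_cell_indic (i : 'I_q) : L (cell_indic i) = cell_comb (row i A).
Proof.
have iq := ltn_ord i.
have Bi := cut_span_endpoints_ctransfer (cut_span_cell_indic iq).
have i0 x : 0 <= cell_indic i x by rewrite cell_indicE//; case: in_cell.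
rewrite {1}(cell_comb_span Bi); congr cell_comb; apply/rowP => j; rewrite !mxE.
have jq := ltn_ord j; have /andP[_ _] := in_cell_pt jq.
have mem k x : (k < q)%N -> dinterval S (b k) (b k.+1) x <-> in_cell k x.
  by move=> kq; apply: mem_dinterval => //; [exact: bS (ltnW kq)|exact: bS|exact: b_incr].
have img y : (sg @` dinterval S (b i) (b i.+1)) y <-> L (cell_indic i) y != 0.
  rewrite -(image_transfer _ i0); split=> -[x xi xy]; exists x => //.
    by rewrite cell_indicE// (proj1 (mem _ _ iq) xi).
  by apply/(mem _ _ iq); move: xi; rewrite cell_indicE//; case: in_cell.
have -> : `[< dinterval S (b j) (b j.+1) `<=` sg @` dinterval S (b i) (b i.+1) >] =
    (L (cell_indic i) (cell_pt j) != 0).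
  apply/asboolP/idP => [h|h x /(mem _ _ jq) xj].
    by apply/img/h/(mem _ _ jq); exact: in_cell_pt.
  by apply/img; rewrite (cut_span_in_cell Bi jq xj).
(* A difference of two cuts with u < v takes only the values 0 and 1, so a nonzero value equals the
   matrix entry 1. *)
suff [u [v [uv Bu Bv ->]]] : exists u v : R, [/\ u < v, endpoints u, endpoints v &
    L (cell_indic i) = cut tau c u - cut tau c v].
  rewrite cont_intB !cutE//; try exact: endpoints_gen_orbit.
  rewrite /cut_fun; have := @above_le _ _ _ u v (cell_pt j) (ltW uv).
  by case: (above v _) => [->|_] //; case: (above u _).
have bi := b_incr iq; have [Bi0 Bi1] := tau_cell iq.
have /andP[bi0 _] := b01 (ltnW iq); have /andP[_ bi1] := b01 iq.
have Sbi := bS (ltnW iq); have Sbi1 := bS iq.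
rewrite /cell_indic ctransferB//; case: (cell_side iq) => h.
  exists (tau (b i)), (tau (b i.+1)); split=> //; first by rewrite (tau_incr tau_unimodal).
  rewrite !ctransfer_cut_left// ?(le_trans (ltW bi) h)//.
  by rewrite opprD addrACA subrr addr0.
exists (tau (b i.+1)), (tau (b i)); split=> //; first by rewrite (tau_decr tau_unimodal).
rewrite !ctransfer_cut_right// ?(le_trans h (ltW bi))//.
by rewrite opprB addrC addrA subrK.
Qed.

Lemma ctransfer_cell_comb v : L (cell_comb v) = cell_comb (v *m A).
Proof.
have Bv := cut_span_endpoints_ctransfer (cut_span_cell_comb v).
rewrite [LHS](cell_comb_span Bv); congr cell_comb; apply/rowP => k; rewrite !mxE.
have Lsum (r : seq 'I_q) (F : 'I_q -> cont_int X) : L (\sum_(j <- r) F j) = \sum_(j <- r) L (F j).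
  exact: (iter_ctransfer_sum tau_unimodal tau_surj 1).
have LMz f m : L (f *~ m) = L f *~ m by exact: (iter_ctransferMz tau_unimodal tau_surj 1).
rewrite /cell_comb Lsum cont_int_sum.
apply: eq_bigr => j _; rewrite LMz cont_intMz.
by rewrite ctransfer_cell_indic cell_comb_pt mxE mulrC.
Qed.

Lemma iter_ctransfer_cell_comb n v : iter n L (cell_comb v) = cell_comb (v *m A ^+ n).
Proof.
elim: n => [|n ih]; first by rewrite expr0 mulmx1.
by rewrite iterS ih ctransfer_cell_comb exprSr -mulmxE mulmxA.
Qed.

(** The graph of the isomorphism. Both groups are quotients, so it is built as a relation on
    representatives, to be shown total, functional, injective, onto and additive. *)
Let rel (u : DG tau c) (l : lim_group A) :=
  exists f n v, [/\ u = dcls f, l = lim_class A (v, n) & iter n L f = cell_comb v].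

Let rel_total u : exists l, rel u l.
Proof.
have [f ->] := dcls_repr u; have [n Bn] := cut_span_eventually f.
pose v : 'rV[int]_q := \row_j iter n L f (cell_pt j).
by exists (lim_class A (v, n)), f, n, v; split=> //; exact: cell_comb_span.
Qed.

(** After n + n' + m iterations of L both vectors are compared as functions on X, and [cell_comb] is
    injective. *)
Let rel_fun u l l' : rel u l -> rel u l' -> l = l'.
Proof.
move=> [f [n [v [-> -> fv]]]] [f' [n' [v' [/(dclsP tau_unimodal tau_surj) [m ff'] -> fv']]]].
apply/eqP/lim_classP; exists m => /=; apply: cell_comb_inj.
rewrite -!iter_ctransfer_cell_comb -fv -fv' -!iterD.
rewrite (_ : n' + m + n = (n' + n) + m)%N; last by lia.
rewrite (_ : n + m + n' = (n' + n) + m)%N; last by lia.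
by rewrite !(iterD (n' + n)) ff'.
Qed.

Let rel_inj u u' l : rel u l -> rel u' l -> u = u'.
Proof.
move=> [f [n [v [-> -> fv]]]] [f' [n' [v' [-> /eqP/lim_classP [k /= kv] fv']]]].
apply/(dclsP tau_unimodal tau_surj); exists (n' + k + n)%N.
rewrite iterD fv iter_ctransfer_cell_comb kv -iter_ctransfer_cell_comb -fv' -iterD.
by congr (iter _ L f'); lia.
Qed.

Let rel_sub u u' l l' : rel u l -> rel u' l' -> rel (u - u') (l - l').
Proof.
move=> [f [n [v [-> -> fv]]]] [f' [n' [v' [-> -> fv']]]].
exists (f - f'), (n + n')%N, (v *m A ^+ n' - v' *m A ^+ n); split.
- by rewrite dclsB.
- have -> : - lim_class A (v', n') = lim_class A (- v', n') := lim_class_opp A v' n'.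
  have -> : lim_class A (v, n) + lim_class A (- v', n') =
      lim_class A (v *m A ^+ n' + (- v') *m A ^+ n, (n + n')%N) := lim_class_add A v n (- v') n'.
  by rewrite mulNmx.
- rewrite iter_ctransferB// cell_combB -!iter_ctransfer_cell_comb -fv -fv' -!iterD.
  by rewrite [(n' + n)%N]addnC.
Qed.

(** The positivity clause serves to realize a positive element of the limit by a nonnegative
    function. *)
Lemma iter_ctransfer_surj n g : exists2 f, iter n L f = g &
  (forall x, 0 <= g x) -> forall x, 0 <= f x.
Proof.
elim: n => [|n [f <- fg]]; first by exists g.
have [h hf hpos] := ctransfer_section tau_unimodal tau_surj f.
by exists h => [|g0]; [rewrite iterSr hf|exact/hpos/fg].
Qed.

Let rel_surj l : exists u, rel u l.
Proof.
rewrite -[l]lim_reprK; case: (repr l) => v n.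
have [f fv _] := iter_ctransfer_surj n (cell_comb v).
by exists (dcls f), f, n, v.
Qed.

Let rel_aut u l : rel u l -> rel (T u) (lim_aut A l).
Proof.
move=> [f [n [v [-> -> fv]]]]; exists (L f), n, (v *m A); split.
- exact: DG_aut_dcls.
- exact: lim_class_aut.
- by rewrite -iterSr iterS fv ctransfer_cell_comb.
Qed.

Lemma iter_ctransfer_ge0 n f : (forall x, 0 <= f x) -> forall x, 0 <= iter n L f x.
Proof.
move=> f0; elim: n => //= n ih x; rewrite ctransferE// /transfer.
by apply: sumr_ge0 => y _; exact: ih.
Qed.

Theorem markov_triple_iso :
  triple_iso (DG_pos tau c) (lim_pos A) (DG_aut tau c) (lim_aut A).
Proof.
pose phi u := sval (cid (rel_total u)).
have phiP u : rel u (phi u) by rewrite /phi; case: cid.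
have phiE u l : rel u l -> phi u = l by move=> h; exact: rel_fun (phiP u) h.
have phiB : zmod_morphism phi by move=> u u'; apply: phiE; exact: rel_sub.
pose phiM := GRing.isZmodMorphism.Build _ _ phi phiB.
pose phiA : {additive DG tau c -> lim_group A} := HB.pack phi phiM.
exists phiA; split.
- pose psi l := sval (cid (rel_surj l)).
  have psiP l : rel (psi l) l by rewrite /psi; case: cid.
  by exists psi => [u|l]; [exact: rel_inj (psiP _) (phiP _)|exact: phiE].
- apply/seteqP; split=> [_ [u [f /= f0 <-] <-]|l [[v n] /= v0 <-]].
    have [f' [n [v [ff' -> fv]]]] := phiP (dcls f).
    have /(dclsP tau_unimodal tau_surj) [m mf] := ff'.
    (* The vector [v] comes from some f' merely equivalent to [f] and may have negative entries.
       After m further steps its entries are values of an iterate of L on [f], hence nonnegative. *)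
    exists (v *m A ^+ m, (n + m)%N) => /=; last first.
      apply/eqP/lim_classP; exists 0%N => /=; rewrite !addn0.
      by rewrite -mulmx_exprD addnC.
    move=> j; rewrite -(cell_comb_pt (v *m A ^+ m)) -iter_ctransfer_cell_comb -fv.
    rewrite -iterD addnC iterD -mf -iterD.
    exact: iter_ctransfer_ge0.
  have v0' x : 0 <= cell_comb v x.
    have [k kq kx] := in_cell_exists x.
    by rewrite (@cell_combE _ (Ordinal kq)).
  have [f fv /(_ v0') f0] := iter_ctransfer_surj n (cell_comb v).
  exists (dcls f); first by exists f.
  by apply: phiE; exists f, n, v.
- by move=> u; apply: phiE; exact: rel_aut.
Qed.

End MarkovTriple.

Theorem theorem9p1 (R : realType) (tau : R -> R) (c : R)
    (tau_unimodal : unimodal tau c) (tau_surj : surjective_on_I tau) :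
  [/\ cyclic_with_generator (DG_aut tau c) (DG_interval tau c 0 1),
      eventually_periodic tau c ->
        markov_map tau c /\
        forall (q : nat) (b : nat -> R), markov_partition tau c q b ->
          let A := incidence_matrix tau c q b in
          triple_iso (DG_pos tau c) (lim_pos A) (DG_aut tau c) (lim_aut A) &
      ~ eventually_periodic tau c ->
        exists phi : {additive DG tau c -> laurent},
          bijective phi /\
          forall x, phi (DG_aut tau c x) = laurent_t * phi x].
Proof.
split=> [|per|aper].
- by rewrite DG_interval01//; exact: DG_cyclic.
- split=> [|q b bm]; first exact: eventually_periodic_markov.
  exact: markov_triple_iso.
- exact: DG_laurent.
Qed.
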